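(* Delay-Robust Path can be solved in $O(|V|^3\cdot|E|^{2x}\cdot x^2)$ time, where $x$ is the number of allowed delays.
   Context: A temporal graph $\mathcal{G}=(V,E)$ consists of a finite vertex set $V$ and a finite set $E$ of time arcs $(v,w,t,\lambda)$ (start vertex $v$, end vertex $w$, time label $t\in\mathbb{N}$, traversal time $\lambda\in\mathbb{N}$). A temporal walk is a sequence of time arcs $(v_i,w_i,t_i,\lambda_i)_{i=1}^{\ell}$ with $v_{i+1}=w_i$ and $t_{i+1}\ge t_i+\lambda_i$. For $D\subseteq E$ and $\delta\in\mathbb{N}$, a $D$-delayed temporal walk is a temporal walk in the graph obtained by increasing the traversal time of each arc of $D$ by $\delta$ (using starting delays, i.e. increasing time labels, gives an equivalent problem). A route is a sequence of vertices, followed by a walk visiting exactly its vertices in order. An $(s,z)$-route is $x$-delay-robust if for every $D\subseteq E$ with $|D|\le x$ some $D$-delayed temporal walk follows it. Delay-Robust Path: given $(\mathcal{G},s,z,x,\delta)$ with $s,z\in V$ and $x,\delta\in\mathbb{N}$, decide whether $\mathcal{G}$ has an $x$-delay-robust $(s,z)$-route. *)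

(* Defs.v *)
From mathcomp Require Import all_boot finmap.
Set Implicit Arguments. Unset Strict Implicit. Unset Printing Implicit Defensive.
Local Open Scope fset_scope.
Local Open Scope nat_scope.

Section TemporalGraphs.
Variable V : finType.

(* (start vertex, end vertex, time label, traversal time) *)
Definition time_arc : Type := V * V * nat * nat.

Definition src (e : time_arc) : V := e.1.1.1.
Definition dst (e : time_arc) : V := e.1.1.2.
Definition label (e : time_arc) : nat := e.1.2.
Definition trav (e : time_arc) : nat := e.2.

Definition tgraph : Type := {fset time_arc}.

(* The empty sequence is the walk of length 0. *)
Definition temporal_walk (G : tgraph) (w : seq time_arc) : Prop :=
  {subset w <= G} /\
  sorted (fun e f => (src f == dst e) && (label e + trav e <= label f)) w.

Definition delay_arc (delta : nat) (D : {fset time_arc}) (e : time_arc) : time_arc :=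
  if e \in D then (src e, dst e, label e, trav e + delta) else e.

Definition delayed_graph (G : tgraph) (delta : nat) (D : {fset time_arc}) : tgraph :=
  [fset delay_arc delta D e | e in G].

(* [belast v p] lists v :: p without its last vertex, so the arcs of w join
   consecutive vertices of v :: p; the walk of length 0 follows every
   one-vertex sequence, and nothing follows the empty one. *)
Definition follows (w : seq time_arc) (r : seq V) : Prop :=
  if r is v :: p then map src w = belast v p /\ map dst w = p else False.

(* Vertices may repeat along a route. *)
Definition is_route (s z : V) (r : seq V) : Prop :=
  if r is v :: p then v = s /\ last v p = z else False.

Definition delay_robust (G : tgraph) (x delta : nat) (r : seq V) : Prop :=
  forall D : {fset time_arc}, D `<=` G -> #|` D| <= x ->
    exists w : seq time_arc,
      temporal_walk (delayed_graph G delta D) w /\ follows w r.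

Definition delay_robust_path (G : tgraph) (s z : V) (x delta : nat) : Prop :=
  exists r : seq V, is_route s z r /\ delay_robust G x delta r.

End TemporalGraphs.

(* Unit-cost random access machine over the natural numbers, with (truncated)
   addition and subtraction as its only arithmetic, as in Cook and Reckhow,
   and with structured control flow in place of jumps (a compilation to jumps
   changes the cost by a constant factor only).  A program mentions finitely
   many registers by number; memory is addressed indirectly via registers. *)
Inductive cmd : Type :=
| Skip
| Const (i c : nat)                  (* r_i := c *)
| Add (i j k : nat)                  (* r_i := r_j + r_k *)
| Sub (i j k : nat)                  (* r_i := r_j - r_k, or 0 if r_j < r_k *)
| Read (i j : nat)                   (* r_i := mem[r_j] *)
| Write (i j : nat)                  (* mem[r_i] := r_j *)
| Seq (c1 c2 : cmd)
| If (i : nat) (c1 c2 : cmd)         (* c1 if r_i > 0, c2 otherwise *)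
| While (i : nat) (c : cmd).         (* repeat c as long as r_i > 0 *)

Record state : Type := State { reg : nat -> nat; memory : nat -> nat }.

Definition upd (f : nat -> nat) (i a : nat) : nat -> nat :=
  fun j => if j == i then a else f j.

Definition set_reg (st : state) (i a : nat) : state :=
  State (upd (reg st) i a) (memory st).

Definition set_mem (st : state) (i a : nat) : state :=
  State (reg st) (upd (memory st) i a).

(* [exec c st k st']: started in st, c halts in st' after exactly k steps,
   where every instruction and every test of a register is one step. *)
Inductive exec : cmd -> state -> nat -> state -> Prop :=
| exec_skip st : exec Skip st 1 st
| exec_const st i c : exec (Const i c) st 1 (set_reg st i c)
| exec_add st i j k :
    exec (Add i j k) st 1 (set_reg st i (reg st j + reg st k))
| exec_sub st i j k :
    exec (Sub i j k) st 1 (set_reg st i (reg st j - reg st k))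
| exec_read st i j :
    exec (Read i j) st 1 (set_reg st i (memory st (reg st j)))
| exec_write st i j :
    exec (Write i j) st 1 (set_mem st (reg st i) (reg st j))
| exec_seq c1 c2 st0 st1 st2 k1 k2 :
    exec c1 st0 k1 st1 -> exec c2 st1 k2 st2 ->
    exec (Seq c1 c2) st0 (k1 + k2) st2
| exec_if_true i c1 c2 st st' k :
    0 < reg st i -> exec c1 st k st' -> exec (If i c1 c2) st k.+1 st'
| exec_if_false i c1 c2 st st' k :
    reg st i = 0 -> exec c2 st k st' -> exec (If i c1 c2) st k.+1 st'
| exec_while_stop i c st :
    reg st i = 0 -> exec (While i c) st 1 st
| exec_while_loop i c st0 st1 st2 k1 k2 :
    0 < reg st0 i -> exec c st0 k1 st1 -> exec (While i c) st1 k2 st2 ->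
    exec (While i c) st0 (k1 + k2).+1 st2.

(* The input occupies the first memory cells; everything else is 0. *)
Definition init (input : seq nat) : state :=
  State (fun=> 0) (fun i => nth 0 input i).

Definition encode_arc (n : nat) (e : time_arc 'I_n) : seq nat :=
  [:: val (src e); val (dst e); label e; trav e].

Definition encode (n : nat) (es : seq (time_arc 'I_n)) (s z : 'I_n)
    (x delta : nat) : seq nat :=
  [:: n; size es; val s; val z; x; delta] ++ flatten (map (@encode_arc n) es).

Definition accepts (st : state) : Prop := 0 < reg st 0.

(* Main.v *)
Require Import Defs.
From mathcomp Require Import all_boot finmap zify.
Set Implicit Arguments. Unset Strict Implicit. Unset Printing Implicit Defensive.
Local Open Scope fset_scope.
Local Open Scope nat_scope.

(* Attach to a route prefix p the vector (a_0, ..., a_x), where a_y is the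
   latest of the earliest arrival times at the end of p over all choices of at
   most y delays.  A traveller who follows the route greedily is hurt by the
   delay of an arc in its last usable step only, so the adversary splits its
   budget between the prefix and the last step: the vector of a longer prefix
   depends only on the last vertex and vector of the shorter one.  The entries
   are among the 2|E|+2 numbers 0, t+l, t+l+delta and a horizon standing for
   "never", hence a breadth-first search over the pairs (vertex, vector) visits
   at most |V| (2|E|+2)^(x+1) of them, at a cost of O(|V| x^2) each once the
   worst delayed arrival over each pair of vertices has been tabulated.  After
   x has been replaced by min(x, |E|), the count (2|E|+2)^(x+1) is O(|E|^(2x)):
   for |E| >= 4 it is at most 16 |E|^(2x). *)

(** * The delay game along a route *)

(** The delays are fixed before the traveller moves, and waiting is free, so against a given set of
    delays the greedy traveller is optimal: a route is robust exactly if the last entry of its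
    vector stays below the horizon. The obstacle is that a route may return to a vertex. One delayed
    arc can then be usable in several steps although the adversary pays for it once, and a recursion
    that charges every step separately might undervalue the adversary. [arrive_early_delays] removes
    this danger. On the machine, the time bound leaves no room for a logarithmic factor spent on
    dictionaries. Every table is addressed directly by a number in mixed radix; the wide index
    ranges cost nothing, because memory starts at 0 and only the cells that are touched are paid
    for. *)

Section Game.
Variables (n : nat) (es : seq (time_arc 'I_n)) (delta H : nat).
Implicit Types (e : time_arc 'I_n) (D : {fset time_arc 'I_n}) (p : seq 'I_n).
Implicit Types (l : seq (time_arc 'I_n)).

Definition arrival e := label e + trav e.

Definition delayed_arrival D e := arrival e + (e \in D) * delta.

Definition usable (t v w : nat) e :=
  [&& val (src e) == v, val (dst e) == w & t <= label e].

Definition hop D (t v w : nat) : nat :=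
  \big[minn/H]_(e <- es | usable t v w e) delayed_arrival D e.

Definition arrive D (s : 'I_n) p : nat * nat :=
  foldl (fun c (w : 'I_n) => (val w, hop D c.2 c.1 w)) (val s, 0) p.

(* Adds an arc with arrival time b to the choice: [r k] is the worst best
   arrival under at most k delays, and the new arc is delayed or not. *)
Definition absorb (b : nat) (r : nat -> nat) (k : nat) : nat :=
  maxn (minn b (r k)) (minn (b + delta) (if k is k'.+1 then r k' else 0)).

Definition worst l (t v w : nat) : nat -> nat :=
  foldl (fun r e => if usable t v w e then absorb (arrival e) r else r)
        (fun=> H) l.

Definition next (v w : nat) (a : nat -> nat) (y : nat) : nat :=
  \max_(k < y.+1) worst es (a (y - k)) v w k.

Definition worst_arrive (s : 'I_n) p : nat * (nat -> nat) :=
  foldl (fun c (w : 'I_n) => (val w, next c.1 w c.2)) (val s, fun=> 0) p.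

Lemma arrive_rcons D s p w :
  arrive D s (rcons p w) =
  (val w, hop D (arrive D s p).2 (arrive D s p).1 w).
Proof. by rewrite /arrive foldl_rcons. Qed.

Lemma worst_arrive_rcons s p w :
  worst_arrive s (rcons p w) =
  (val w, next (worst_arrive s p).1 w (worst_arrive s p).2).
Proof. by rewrite /worst_arrive foldl_rcons. Qed.

Lemma arrive1 D s p : (arrive D s p).1 = last s p.
Proof.
by case/lastP: p => [|p w] //; rewrite arrive_rcons last_rcons.
Qed.

Lemma worst_arrive1 s p : (worst_arrive s p).1 = last s p.
Proof.
by case/lastP: p => [|p w] //; rewrite worst_arrive_rcons last_rcons.
Qed.

Lemma worst_rcons l e t v w :
  worst (rcons l e) t v w =
  if usable t v w e then absorb (arrival e) (worst l t v w) else worst l t v w.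
Proof. by rewrite /worst foldl_rcons. Qed.

(** Describing the minimum by its lower bounds lets the later estimates argue about one arc at a
    time. *)
Lemma leq_hop u D t v w :
  (u <= hop D t v w) =
  (u <= H) && all (fun e => usable t v w e ==> (u <= delayed_arrival D e)) es.
Proof.
rewrite /hop; elim: es => [|e l IH] /=; first by rewrite big_nil andbT.
rewrite big_cons; case: (usable _ _ _ _) => //=.
by rewrite leq_min IH andbCA.
Qed.

Lemma hop_ge u D t v w : u <= H ->
  (forall e, e \in es -> usable t v w e -> u <= delayed_arrival D e) ->
  u <= hop D t v w.
Proof.
move=> uH h; rewrite leq_hop uH; apply/allP => e ein.
by apply/implyP; apply: h.
Qed.

Lemma hop_le_horizon D t v w : hop D t v w <= H.
Proof. by have := leqnn (hop D t v w); rewrite leq_hop => /andP[]. Qed.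

Lemma hop_le D t v w e : e \in es -> usable t v w e ->
  hop D t v w <= delayed_arrival D e.
Proof.
move=> ein ue; have := leqnn (hop D t v w).
by rewrite leq_hop => /andP[_ /allP/(_ e ein)]; rewrite ue.
Qed.

Lemma hop_attained D t v w : hop D t v w < H ->
  exists e, [/\ e \in es, usable t v w e & hop D t v w = delayed_arrival D e].
Proof.
move=> lt; have := ltnn (hop D t v w).
rewrite leq_hop lt /= => /negbT/allPn[e ein].
rewrite negb_imply -ltnNge => /andP[ue le]; exists e; split=> //.
by apply/eqP; rewrite eqn_leq hop_le.
Qed.

Lemma leq_delayed_arrival D D' e :
  (e \in D -> e \in D') -> delayed_arrival D e <= delayed_arrival D' e.
Proof.
by move=> s; rewrite leq_add2l leq_mul2r; case: (e \in D) s => [->|]; rewrite ?orbT.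
Qed.

Lemma usable_leq t t' v w e : t <= t' -> usable t' v w e -> usable t v w e.
Proof. by rewrite /usable => le /and3P[-> -> /(leq_trans le) ->]. Qed.

Lemma leq_hop2 D D' t t' v w : D `<=` D' -> t <= t' ->
  hop D t v w <= hop D' t' v w.
Proof.
move=> sub le; apply: hop_ge; first exact: hop_le_horizon.
move=> e ein /(usable_leq le) ue; apply: leq_trans (hop_le _ ein ue) _.
exact/leq_delayed_arrival/(fsubsetP sub).
Qed.

(** An arbitrary lower bound [u] stands in for the minimum, since the induction passes to prefixes
    of the arc list, over which the minimum itself would change. Only usable delayed arcs consume
    budget: each takes the second branch of [absorb], every other arc leaves [k] alone. *)
Lemma hop_le_worst u D t v w k : u <= H ->
  forall l, (forall e, e \in l -> usable t v w e -> u <= delayed_arrival D e) ->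
  count (fun e => usable t v w e && (e \in D)) l <= k ->
  u <= worst l t v w k.
Proof.
move=> uH l; elim/last_ind: l k => [|l e IH] k // h.
rewrite worst_rcons -cats1 count_cat /= addn0.
have hl e' : e' \in l -> usable t v w e' -> u <= delayed_arrival D e'.
  by move=> ein; apply: h; rewrite mem_rcons inE ein orbT.
have := h e; rewrite mem_rcons inE eqxx /= => /(_ isT).
case: (usable t v w e) => [/(_ isT)|_]; last by rewrite addn0 => /IH; exact.
rewrite /delayed_arrival /absorb /= leq_max !leq_min.
case: (e \in D) => /=.
  rewrite addn1 mul1n => -> /=; case: k => // k; rewrite ltnS => /IH -> //.
  by rewrite orbT.
by rewrite addn0 mul0n addn0 => -> /IH ->.
Qed.

Lemma absorb_cases b r k : absorb b r k = minn b (r k) \/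
  exists2 k', k = k'.+1 & absorb b r k = minn (b + delta) (r k').
Proof.
rewrite /absorb; case: k => [|k]; first by left; rewrite minn0 maxn0.
by rewrite /maxn; case: ifP => _; [right; exists k | left].
Qed.

(** The adversary's choice is read off the recursion: the branch that attains the maximum in
    [absorb] tells whether the last arc is delayed. *)
Lemma worst_le_hop t v w k l :
  exists D, [/\ {subset D <= l}, #|` D| <= k, worst l t v w k <= H
    & forall e, e \in l -> usable t v w e ->
        worst l t v w k <= delayed_arrival D e].
Proof.
elim/last_ind: l k => [|l e IH] k; first by exists fset0; rewrite cardfs0.
rewrite worst_rcons; have [D [Dl Dk DH le]] := IH k.
have subr (D' : {fset time_arc 'I_n}) :
    {subset D' <= l} -> {subset D' <= rcons l e}.
  by move=> s f /s; rewrite mem_rcons inE orbC => ->.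
have first_case : exists D', [/\ {subset D' <= rcons l e}, #|` D'| <= k,
      minn (arrival e) (worst l t v w k) <= H
    & forall f, f \in rcons l e -> usable t v w f ->
        minn (arrival e) (worst l t v w k) <= delayed_arrival D' f].
  exists D; split; [exact: subr|by []|by rewrite geq_min DH orbT|].
  move=> f; rewrite mem_rcons inE => /orP[/eqP-> _|fl uf].
    by rewrite geq_min leq_addr.
  by rewrite geq_min le ?orbT.
case ue: (usable t v w e); last first.
  exists D; split=> //; first exact: subr.
  move=> f; rewrite mem_rcons inE => /orP[/eqP->|]; first by rewrite ue.
  exact: le.
have [->//|[k' kE]] := absorb_cases (arrival e) (worst l t v w) k.
move=> ->; rewrite {}kE {k D Dl Dk DH le first_case}; rename k' into k.
have [D [Dl Dk DH le]] := IH k; exists (e |` D); split.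
- by move=> f; rewrite !inE mem_rcons inE => /orP[->//|/Dl->]; rewrite orbT.
- by rewrite (leq_trans (leq_card_fsetU _ _)) // cardfs1.
- by rewrite geq_min DH orbT.
- move=> f; rewrite mem_rcons inE => /orP[/eqP-> _|fl uf].
    by rewrite geq_min /delayed_arrival !inE eqxx mul1n leqnn.
  rewrite geq_min (leq_trans (le _ fl uf)) ?orbT //.
  by apply: leq_delayed_arrival => fD; rewrite !inE fD orbT.
Qed.

(** Only the delays that matter in this step are charged, which leaves the rest of the budget to the
    prefix. As [es] has no repetitions, the fold pays for each of them once. *)
Lemma hop_hop_worst (uniq_es : uniq es) D t v w :
  hop D t v w <= worst es t v w #|` [fset e in D | usable t v w e]|.
Proof.
apply: (@hop_le_worst _ D) => //; first exact: hop_le_horizon.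
  by move=> e; apply: hop_le.
rewrite -size_filter; apply: uniq_leq_size; first exact: filter_uniq.
by move=> e; rewrite mem_filter !inE /= => /andP[/andP[-> ->]].
Qed.

Lemma worst_hop t v w k :
  exists D, [/\ {subset D <= es}, #|` D| <= k & worst es t v w k <= hop D t v w].
Proof.
have [D [Dl Dk DH le]] := worst_le_hop t v w k es; exists D; split=> //.
exact: hop_ge.
Qed.

(** A later start leaves fewer arcs usable, so the delays that are optimal from [t] force at least
    the same arrival from [t']. *)
Lemma leq_worst (uniq_es : uniq es) t t' v w k : t <= t' ->
  worst es t v w k <= worst es t' v w k.
Proof.
move=> tt; have [D [_ Dk DH le]] := worst_le_hop t v w k es.
apply: (@hop_le_worst _ D) => //.
  by move=> e ein /(usable_leq tt); apply: le.
apply: leq_trans Dk; rewrite -size_filter; apply: uniq_leq_size.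
  exact: filter_uniq.
by move=> e; rewrite mem_filter => /andP[/andP[]].
Qed.

Lemma leq_arrive D D' s p : D `<=` D' -> (arrive D s p).2 <= (arrive D' s p).2.
Proof.
move=> sub; elim/last_ind: p => // p w IH; rewrite !arrive_rcons /= !arrive1.
exact: leq_hop2.
Qed.

Lemma arrive_mono D s p w : (arrive D s p).2 <= H ->
  (arrive D s p).2 <= (arrive D s (rcons p w)).2.
Proof.
move=> tH; rewrite arrive_rcons; apply: hop_ge => // e _ /and3P[_ _ le].
by apply: leq_trans le _; rewrite /delayed_arrival /arrival -!addnA leq_addr.
Qed.

Lemma arrive_le_horizon D s p : (arrive D s p).2 <= H.
Proof.
by case/lastP: p => // p w; rewrite arrive_rcons hop_le_horizon.
Qed.

(* An arc that leaves at or after the final arrival time cannot improve it,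
   so removing its delay does not help the traveller: when an arc is usable in
   several steps of the route, its delay matters in the last of them only. *)
Lemma arrive_early_delays D D' s p :
  (forall e, e \in D -> label e < (arrive D s p).2 -> e \in D') ->
  (arrive D s p).2 <= (arrive D' s p).2.
Proof.
elim/last_ind: p => // p w IH h.
have le := arrive_mono w (arrive_le_horizon D s p).
have {}IH := IH (fun e eD lt => h e eD (leq_trans lt le)).
move: h le; rewrite !arrive_rcons /= !arrive1.
set t := (arrive D s p).2 in IH *; set u := hop _ _ _ _ => h le.
apply: hop_ge => [|e ein ue]; first exact: hop_le_horizon.
have := hop_le D ein (usable_leq IH ue); rewrite -/u /delayed_arrival.
case eD: (e \in D); last by rewrite addn0 => /leq_trans-> //; rewrite leq_addr.
case: (ltnP (label e) u) => [/(h e eD)->//|lab _].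
by rewrite (leq_trans lab) // /arrival -addnA leq_addr.
Qed.

(** With [t] the arrival at the end of the prefix under all of [D], the delays in [late] are charged
    to the last step and the others to the prefix. Arcs in [late] leave at [t] or later, so by
    [arrive_early_delays] the prefix still takes until [t] without their delays. *)
Lemma arrive_le_worst (uniq_es : uniq es) D s p y : #|` D| <= y ->
  (arrive D s p).2 <= (worst_arrive s p).2 y.
Proof.
elim/last_ind: p D y => // p w IH D y Dy.
rewrite arrive_rcons worst_arrive_rcons /= arrive1 worst_arrive1.
set t := (arrive D s p).2; pose late := [fset e in D | usable t (last s p) w e].

have leD : #|` late| + #|` D `\` late| = #|` D|.
  rewrite -(cardfsID late D); congr (#|` _| + _).
  by apply/fsetP => e; rewrite !inE /=; case: (e \in D).
have ly : #|` late| <= y by apply: leq_trans Dy; rewrite -leD leq_addr.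
apply: leq_trans (leq_bigmax (Ordinal (ly : _ < y.+1))) => /=.
apply: leq_trans (hop_hop_worst uniq_es _ _ _ _) _; rewrite -/late.
apply: leq_worst => //; apply: leq_trans (IH (D `\` late) _ _); last first.
  by rewrite -(leq_add2l #|` late|) leD subnKC.
apply: arrive_early_delays => e eD lt.
by rewrite !inE eD /usable leqNgt lt !andbF.
Qed.

(** The optimal delays for the prefix and for the last step are united. Their budgets add up to [y],
    and neither set loses its effect, because further delays never make an arrival earlier. *)
Lemma worst_arrive_attained s p y : exists D,
  [/\ {subset D <= es}, #|` D| <= y & (worst_arrive s p).2 y <= (arrive D s p).2].
Proof.
elim/last_ind: p y => [|p w IH] y; first by exists fset0; rewrite cardfs0.
rewrite worst_arrive_rcons /= worst_arrive1.
pose F (k : 'I_y.+1) :=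
  worst es ((worst_arrive s p).2 (y - k)) (last s p) w k.
have card_pos : 0 < #|'I_y.+1| by rewrite card_ord.
have [k ek] := eq_bigmax F card_pos.
rewrite /next -/F {}ek /F.
have [D1 [D1es D1y le1]] := IH (y - k).
have [D2 [D2es D2k le2]] :=
  worst_hop ((worst_arrive s p).2 (y - k)) (last s p) w k.
exists (D1 `|` D2); split.
- by move=> e; rewrite inE => /orP[/D1es|/D2es].
- apply: leq_trans (leq_card_fsetU _ _) _.
  by rewrite -[leqRHS](subnK (ltn_ord k : k <= y)) leq_add.
- apply: leq_trans le2 _; rewrite arrive_rcons /= arrive1.
  apply: leq_hop2; rewrite ?fsubsetUr // (leq_trans le1) //.
  by rewrite leq_arrive // fsubsetUl.
Qed.

(** * Greedy arrival times and delayed walks *)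

Hypothesis horizon_gt0 : 0 < H.
Hypothesis arrival_lt : forall e, e \in es -> arrival e + delta < H.

Let follow_rel (e f : time_arc 'I_n) :=
  (src f == dst e) && (label e + trav e <= label f).

Lemma follows_rcons (w : seq (time_arc 'I_n)) f (s v : 'I_n) p :
  follows (rcons w f) (s :: rcons p v) <->
  [/\ follows w (s :: p), src f = last s p & dst f = v].
Proof.
rewrite /follows !map_rcons belast_rcons lastI; split.
  by case=> /rcons_inj[<- <-] /rcons_inj[<- <-].
by case=> [[-> ->] -> ->].
Qed.

(** The default 0 is below every label, so appending the first arc of a walk needs no separate
    case. *)
Definition finish (w : seq (time_arc 'I_n)) : nat := last 0 (map arrival w).

Lemma sorted_follow_rcons (w : seq (time_arc 'I_n)) f s p :
  follows w (s :: p) -> src f = last s p ->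
  sorted follow_rel (rcons w f) =
  sorted follow_rel w && (finish w <= label f).
Proof.
case: w => [|e w] //; case: p => [|v p]; try by case.
move=> [_ [ev wp]] fs; rewrite rcons_cons /= rcons_path /follow_rel fs.
rewrite /finish /= last_map -/(arrival _); congr (_ && _).
by rewrite -[X in _ == X](last_map (@dst _)) wp ev eqxx.
Qed.

Variable E : tgraph 'I_n.
Hypothesis esE : es =i E.

Lemma mem_delayed_graph D f :
  reflect (exists2 e, e \in es & f = delay_arc delta D e)
          (f \in delayed_graph E delta D).
Proof.
apply: (iffP (imfsetP _ _ _ _)) => [[e ein ->]|[e ein ->]]; exists e => //.
  by rewrite esE.
by rewrite -esE.
Qed.

Lemma delay_arcE D e : [/\ src (delay_arc delta D e) = src e,
  dst (delay_arc delta D e) = dst e, label (delay_arc delta D e) = label e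
  & arrival (delay_arc delta D e) = delayed_arrival D e].
Proof.
rewrite /delay_arc /delayed_arrival.
by case: (e \in D); split=> //=; rewrite ?mul1n ?addn0 // /arrival addnA.
Qed.

(** Arriving earlier keeps every arc usable, so no walk beats the greedy times. Since real arcs
    arrive before [H], a walk also certifies that the greedy time is not the value for an impossible
    step. *)
Lemma arrive_le_walk D s p w :
  temporal_walk (delayed_graph E delta D) w -> follows w (s :: p) ->
  (arrive D s p).2 <= finish w /\ (arrive D s p).2 < H.
Proof.
elim/last_ind: p w => [|p v IH] w //.
case/lastP: w => [|w f]; first by move=> _ []; case: p {IH}.
move=> [sub srt] /follows_rcons[fw fs fv].
move: srt; rewrite -[sorted _ _]/(sorted follow_rel _).
rewrite (sorted_follow_rcons fw fs) => /andP[srt fin].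
have [|le _] := IH w _ fw.
  by split=> // e ew; apply: sub; rewrite mem_rcons inE ew orbT.
have /mem_delayed_graph[e ein fe] : f \in delayed_graph E delta D.
  by apply: sub; rewrite mem_rcons inE eqxx.
have [se de le_ ae] := delay_arcE D e.
have ue : usable (arrive D s p).2 (last s p) v e.
  by rewrite /usable -se -de -le_ -fe fs fv !eqxx (leq_trans le).
have := hop_le D ein ue; rewrite arrive_rcons /= arrive1.
rewrite /finish map_rcons last_rcons fe ae => hle; split=> //.
apply: leq_ltn_trans hle _; apply: leq_ltn_trans (arrival_lt ein).
by rewrite leq_add2l; case: (_ \in _); rewrite ?mul1n.
Qed.

(** A minimum below [H] is attained by an arc, and arrivals never decrease along the route, so all
    earlier minima are below [H] too; the chosen arcs form the walk. *)
Lemma walk_arrive D s p : (arrive D s p).2 < H -> exists w,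
  [/\ temporal_walk (delayed_graph E delta D) w, follows w (s :: p)
    & finish w = (arrive D s p).2].
Proof.
elim/last_ind: p => [_|p v IH]; first by exists [::].
move=> lt; have [|w [[sub srt] fw fin]] := IH.
  exact: leq_ltn_trans (arrive_mono v (arrive_le_horizon D s p)) lt.
move: lt; rewrite arrive_rcons /= arrive1 => /hop_attained[e [ein ue ->]].
have [se de le_ ae] := delay_arcE D e.
case/and3P: ue => /eqP/val_inj es_ /eqP/val_inj ed el.
exists (rcons w (delay_arc delta D e)).
have ff : src (delay_arc delta D e) = last s p by rewrite se.
split.
- split.
    move=> f; rewrite mem_rcons inE => /orP[/eqP->|/sub//].
    by apply/mem_delayed_graph; exists e.
  rewrite -[sorted _ _]/(sorted follow_rel _) (sorted_follow_rcons fw ff).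
  by rewrite srt fin le_.
- by apply/follows_rcons; rewrite de.
- by rewrite /finish map_rcons last_rcons ae.
Qed.

(** The budget may be cut to the number of arcs because a set of delays is a subset of [E]. *)
Lemma delay_robust_worst_arrive (uniq_es : uniq es) s p x :
  delay_robust E x delta (s :: p) <->
  (worst_arrive s p).2 (minn x (size es)) < H.
Proof.
have cardE : #|` E| = size es.
  by apply/perm_size/uniq_perm => // e; rewrite esE.
split=> [rob|lt D sub Dx].
  have [D [Des Dx le]] := worst_arrive_attained s p (minn x (size es)).
  have [|| w [tw fw]] := rob D.
  - by apply/fsubsetP => e /Des; rewrite esE.
  - by rewrite (leq_trans Dx) // geq_minl.
  by apply: leq_ltn_trans le _; case: (arrive_le_walk tw fw).
have {}Dx : #|` D| <= minn x (size es).
  by rewrite leq_min Dx -cardE fsubset_leq_card.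
have [|w [tw fw _]] := @walk_arrive D s p; [|by exists w].
exact: leq_ltn_trans (arrive_le_worst uniq_es s p Dx) lt.
Qed.

Lemma delay_robust_path_worst_arrive (uniq_es : uniq es) s z x :
  delay_robust_path E s z x delta <->
  exists p, last s p = z /\ (worst_arrive s p).2 (minn x (size es)) < H.
Proof.
split=> [[[|v p] []]//|[p [lz]]].
  by case=> -> lz /(delay_robust_worst_arrive uniq_es) lt; exists p.
by move=> /(delay_robust_worst_arrive uniq_es) rob; exists (s :: p).
Qed.

End Game.

(** * A language with expressions and arrays, compiled to the machine *)

Inductive expr : Type :=
| Cst (c : nat)
| Var (i : nat)
| Plus (e1 e2 : expr)
| Minus (e1 e2 : expr)
| Get (a : nat) (e : expr)
| Inp (e : expr).

Inductive com : Type :=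
| Assign (i : nat) (e : expr)
| Put (a : nat) (e1 e2 : expr)
| Sequ (c1 c2 : com)
| Cond (e : expr) (c1 c2 : com)
| Loop (e : expr) (c : com).

Record hstate : Type := HState { var : nat -> nat; arr : nat -> nat -> nat }.

Definition set_var (h : hstate) (i v : nat) : hstate :=
  HState (fun j => if j == i then v else var h j) (arr h).

Definition set_arr (h : hstate) (a i v : nat) : hstate :=
  HState (var h)
    (fun b => if b == a then (fun j => if j == i then v else arr h a j)
              else arr h b).

Section Language.
Variable input : seq nat.

Fixpoint eval (h : hstate) (e : expr) : nat :=
  match e with
  | Cst c => c
  | Var i => var h i
  | Plus e1 e2 => eval h e1 + eval h e2
  | Minus e1 e2 => eval h e1 - eval h e2
  | Get a e => arr h a (eval h e)
  | Inp e => nth 0 input (eval h e)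
  end.

Inductive hexec : com -> hstate -> nat -> hstate -> Prop :=
| hexec_assign h i e : hexec (Assign i e) h 1 (set_var h i (eval h e))
| hexec_put h a e1 e2 :
    hexec (Put a e1 e2) h 1 (set_arr h a (eval h e1) (eval h e2))
| hexec_sequ c1 c2 h0 h1 h2 k1 k2 :
    hexec c1 h0 k1 h1 -> hexec c2 h1 k2 h2 ->
    hexec (Sequ c1 c2) h0 (k1 + k2) h2
| hexec_cond_true e c1 c2 h h' k :
    0 < eval h e -> hexec c1 h k h' -> hexec (Cond e c1 c2) h k.+1 h'
| hexec_cond_false e c1 c2 h h' k :
    eval h e = 0 -> hexec c2 h k h' -> hexec (Cond e c1 c2) h k.+1 h'
| hexec_loop_stop e c h : eval h e = 0 -> hexec (Loop e c) h 1 h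
| hexec_loop_go e c h0 h1 h2 k1 k2 :
    0 < eval h0 e -> hexec c h0 k1 h1 -> hexec (Loop e c) h1 k2 h2 ->
    hexec (Loop e c) h0 (k1 + k2).+1 h2.

(* Variable i lives in register 2i, the temporaries in the odd registers from
   3 on; register 1 holds the length of the input.  Entry i of array a < 16 is
   stored in the memory cell 16i + a counted from the end of the input. *)
Definition tmp (d : nat) : nat := (2 * d + 3)%N.

Definition cell (d a : nat) : cmd :=
  Seq (Add (tmp d) (tmp d) (tmp d)) (Seq (Add (tmp d) (tmp d) (tmp d))
  (Seq (Add (tmp d) (tmp d) (tmp d)) (Seq (Add (tmp d) (tmp d) (tmp d))
  (Seq (Add (tmp d) (tmp d) 1) (Seq (Const (tmp d.+1) a)
  (Add (tmp d) (tmp d) (tmp d.+1))))))).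

(** The odd registers serve as an evaluation stack, with the result at depth [d]. Cells beyond the
    input hold arrays, so [Inp] tests its index first and returns the default 0 of [nth] when it is
    out of range. *)
Fixpoint compile_expr (e : expr) (d : nat) : cmd :=
  match e with
  | Cst c => Const (tmp d) c
  | Var i => Seq (Const (tmp d) 0) (Add (tmp d) (tmp d) (2 * i))
  | Plus e1 e2 => Seq (compile_expr e1 d) (Seq (compile_expr e2 d.+1)
                    (Add (tmp d) (tmp d) (tmp d.+1)))
  | Minus e1 e2 => Seq (compile_expr e1 d) (Seq (compile_expr e2 d.+1)
                    (Defs.Sub (tmp d) (tmp d) (tmp d.+1)))
  | Get a e => Seq (compile_expr e d) (Seq (cell d a) (Read (tmp d) (tmp d)))
  | Inp e => Seq (compile_expr e d) (Seq (Defs.Sub (tmp d.+1) 1 (tmp d))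
               (If (tmp d.+1) (Read (tmp d) (tmp d)) (Const (tmp d) 0)))
  end.

Fixpoint compile (c : com) : cmd :=
  match c with
  | Assign i e => Seq (compile_expr e 0)
                    (Seq (Const (tmp 1) 0) (Add (2 * i) (tmp 0) (tmp 1)))
  | Put a e1 e2 => Seq (compile_expr e1 0) (Seq (cell 0 a)
                     (Seq (compile_expr e2 1) (Write (tmp 0) (tmp 1))))
  | Sequ c1 c2 => Seq (compile c1) (compile c2)
  | Cond e c1 c2 => Seq (compile_expr e 0) (If (tmp 0) (compile c1) (compile c2))
  | Loop e c => Seq (compile_expr e 0)
                  (While (tmp 0) (Seq (compile c) (compile_expr e 0)))
  end.

Fixpoint expr_ok (e : expr) : bool :=
  match e with
  | Cst _ | Var _ => true
  | Plus e1 e2 | Minus e1 e2 => expr_ok e1 && expr_ok e2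
  | Get a e => (a < 16) && expr_ok e
  | Inp e => expr_ok e
  end.

Fixpoint com_ok (c : com) : bool :=
  match c with
  | Assign _ e => expr_ok e
  | Put a e1 e2 => [&& a < 16, expr_ok e1 & expr_ok e2]
  | Sequ c1 c2 => com_ok c1 && com_ok c2
  | Cond e c1 c2 => [&& expr_ok e, com_ok c1 & com_ok c2]
  | Loop e c => expr_ok e && com_ok c
  end.

Fixpoint expr_cost (e : expr) : nat :=
  match e with
  | Cst _ => 1
  | Var _ => 2
  | Plus e1 e2 | Minus e1 e2 => expr_cost e1 + expr_cost e2 + 1
  | Get _ e => expr_cost e + 8
  | Inp e => expr_cost e + 3
  end.

Fixpoint com_cost (c : com) : nat :=
  match c with
  | Assign _ e => expr_cost e + 2
  | Put _ e1 e2 => expr_cost e1 + expr_cost e2 + 8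
  | Sequ c1 c2 => com_cost c1 + com_cost c2
  | Cond e c1 c2 => expr_cost e + 1 + com_cost c1 + com_cost c2
  | Loop e c => expr_cost e + 1 + com_cost c
  end.

Definition represents (h : hstate) (st : state) : Prop :=
  [/\ reg st 1 = size input,
      forall i, reg st (2 * i) = var h i,
      forall i, i < size input -> memory st i = nth 0 input i
    & forall a i, a < 16 -> memory st (size input + 16 * i + a) = arr h a i].

(** The protected registers are the variables (even), the input length in register 1 and the pending
    temporaries of enclosing expressions. *)
Definition keeps (d : nat) (st st' : state) : Prop :=
  memory st' = memory st /\
  forall r, ~~ odd r || (r < tmp d) -> reg st' r = reg st r.

Lemma represents_keeps h st st' :
  represents h st -> keeps 0 st st' -> represents h st'.
Proof.
move=> [r1 rv ri ra] [em er]; split=> [|i|i|a i].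
- by rewrite er.
- by rewrite er ?rv // mul2n odd_double.
- by rewrite em; apply: ri.
- by rewrite em; apply: ra.
Qed.

Lemma keeps_trans d st0 st1 st2 :
  keeps d st0 st1 -> keeps d st1 st2 -> keeps d st0 st2.
Proof.
by move=> [m1 r1] [m2 r2]; split=> [|r hr]; rewrite ?m2 ?r2 ?r1.
Qed.

Lemma keepsS d st st' : keeps d.+1 st st' -> keeps d st st'.
Proof.
move=> [m r]; split=> // i /orP[ei|li]; apply: r; rewrite ?ei //.
by apply/orP; right; move: li; rewrite /tmp; lia.
Qed.

Lemma keeps_set d i v st : d <= i -> keeps d st (set_reg st (tmp i) v).
Proof.
move=> di; split=> //= r /orP hr; rewrite /upd; case: eqP => // er; exfalso.
by move: hr; rewrite er /tmp; lia.
Qed.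

Lemma upd_same f i a : upd f i a i = a.
Proof. by rewrite /upd eqxx. Qed.

Lemma upd_other f i a j : j != i -> upd f i a j = f j.
Proof. by rewrite /upd => /negbTE->. Qed.

Lemma cell_correct st d a : exists st',
  [/\ exec (cell d a) st 7 st', keeps d st st'
    & reg st' (tmp d) = reg st 1 + 16 * reg st (tmp d) + a].
Proof.
eexists; split; first by rewrite -[7]/(1+(1+(1+(1+(1+(1+1)))))); do 6!
  (apply: exec_seq; first by constructor); constructor.
  by do !(apply: keeps_trans; last by apply: keeps_set; lia).
rewrite /= !upd_same; set t := tmp d; set t' := tmp d.+1.
have n1 : (t == t') = false by rewrite /t /t' /tmp; lia.
have n2 : (1 == t) = false by rewrite /t /tmp; lia.
by rewrite /upd ?eqxx ?n1 ?n2 /= ?eqxx ?n1 ?n2; lia.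
Qed.

Lemma compile_expr_correct h e : expr_ok e -> forall d st, represents h st ->
  exists k st', [/\ exec (compile_expr e d) st k st', k <= expr_cost e,
    keeps d st st' & reg st' (tmp d) = eval h e].
Proof.
have rep_keeps d st st' : represents h st -> keeps d st st' -> represents h st'.
  move=> rep; elim: d => [|d IH] k; first exact: represents_keeps k.
  exact/IH/keepsS.
elim: e => [c|i|e1 IH1 e2 IH2|e1 IH1 e2 IH2|a e IH|e IH] /= ok d st rep.
- exists 1, (set_reg st (tmp d) c); split; rewrite /= ?upd_same //.
    by constructor.
  exact: keeps_set.
- exists (1 + 1), (set_reg (set_reg st (tmp d) 0) (tmp d)
    (reg (set_reg st (tmp d) 0) (tmp d) +
     reg (set_reg st (tmp d) 0) (2 * i))).
  split=> //.
  + by apply: exec_seq (exec_const _ _ _) (exec_add _ _ _ _).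
  + by do !(apply: keeps_trans; last by apply: keeps_set).
  + rewrite /= !upd_same add0n upd_other; last by rewrite /tmp; lia.
    by case: rep.
- case/andP: ok => /IH1{}IH1 /IH2{}IH2.
  have [k1 [st1 [x1 l1 kp1 v1]]] := IH1 d st rep.
  have [k2 [st2 [x2 l2 kp2 v2]]] := IH2 d.+1 st1 (rep_keeps _ _ _ rep kp1).
  exists (k1 + (k2 + 1)); eexists; split.
  + by apply: exec_seq x1 _; apply: exec_seq x2 _; constructor.
  + by lia.
  + apply: keeps_trans kp1 _; apply: keeps_trans (keepsS kp2) _.
    exact: keeps_set.
  + rewrite /= upd_same v2; case: kp2 => _ ->; first by rewrite v1.
    by apply/orP; right; rewrite /tmp; lia.
- case/andP: ok => /IH1{}IH1 /IH2{}IH2.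
  have [k1 [st1 [x1 l1 kp1 v1]]] := IH1 d st rep.
  have [k2 [st2 [x2 l2 kp2 v2]]] := IH2 d.+1 st1 (rep_keeps _ _ _ rep kp1).
  exists (k1 + (k2 + 1)); eexists; split.
  + by apply: exec_seq x1 _; apply: exec_seq x2 _; constructor.
  + by lia.
  + apply: keeps_trans kp1 _; apply: keeps_trans (keepsS kp2) _.
    exact: keeps_set.
  + rewrite /= upd_same v2; case: kp2 => _ ->; first by rewrite v1.
    by apply/orP; right; rewrite /tmp; lia.
- case/andP: ok => la /IH{}IH.
  have [k1 [st1 [x1 l1 kp1 v1]]] := IH d st rep.
  have [st2 [x2 kp2 v2]] := cell_correct st1 d a.
  exists (k1 + (7 + 1)); eexists; split.
  + by apply: exec_seq x1 _; apply: exec_seq x2 _; constructor.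
  + by lia.
  + apply: keeps_trans kp1 _; apply: keeps_trans kp2 _; exact: keeps_set.
  + rewrite /= upd_same v2; have [r1 _ _ <- //] := rep_keeps _ _ _ rep kp1.
    by case: kp2 => -> _; rewrite r1 v1.
- have [k1 [st1 [x1 l1 kp1 v1]]] := IH ok d st rep.
  have rep1 := rep_keeps _ _ _ rep kp1; have [r1 _ ri _] := rep1.
  have n1 : 1 == tmp d.+1 = false by rewrite /tmp; lia.
  have n2 : tmp d == tmp d.+1 = false by rewrite /tmp; lia.
  set st2 := set_reg st1 (tmp d.+1) (size input - eval h e).
  have x2 : exec (Defs.Sub (tmp d.+1) 1 (tmp d)) st1 1 st2.
    by rewrite /st2 -v1 -r1; constructor.
  exists (k1 + (1 + 2)).
  have kp2 : keeps d st1 st2 by apply: keeps_set.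
  case: (ltnP (eval h e) (size input)) => le.
  + exists (set_reg st2 (tmp d) (memory st2 (reg st2 (tmp d)))); split.
    * apply: exec_seq x1 _; apply: exec_seq x2 _; apply: exec_if_true.
        by rewrite /= upd_same subn_gt0.
      by constructor.
    * by lia.
    * apply: keeps_trans kp1 _; apply: keeps_trans kp2 _; exact: keeps_set.
    * by rewrite /= upd_same /upd n2 v1 ri.
  + exists (set_reg st2 (tmp d) 0); split.
    * apply: exec_seq x1 _; apply: exec_seq x2 _; apply: exec_if_false.
        by rewrite /= upd_same; apply/eqP; rewrite subn_eq0.
      by constructor.
    * by lia.
    * apply: keeps_trans kp1 _; apply: keeps_trans kp2 _; exact: keeps_set.
    * by rewrite /= upd_same nth_default.
Qed.

Lemma represents_set_var h st i v :
  represents h st -> represents (set_var h i v) (set_reg st (2 * i) v).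
Proof.
move=> [r1 rv ri ra]; split=> //= [|j].
  by rewrite upd_other //; lia.
rewrite /upd; have -> : (2 * j == 2 * i) = (j == i) by lia.
by case: eqP => // _; apply: rv.
Qed.

Lemma represents_set_arr h st a i v : a < 16 -> represents h st ->
  represents (set_arr h a i v) (set_mem st (size input + 16 * i + a) v).
Proof.
move=> la [r1 rv ri ra]; split=> //= [j lj|b j lb].
  by rewrite upd_other ?ri //; lia.
rewrite /upd; case: (b =P a) => [->|ba].
  have -> : (size input + 16 * j + a == size input + 16 * i + a) = (j == i).
    by lia.
  by case: ifP => // _; apply: ra.
by rewrite ifF ?ra //; apply/negP => /eqP; lia.
Qed.

(** Every source step is charged the static cost [K] of an entire program, which is a constant; this
    spares any account of which subcommand is running. *)
Lemma compile_correct K c h k h' : hexec c h k h' -> com_ok c ->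
  com_cost c <= K -> forall st, represents h st ->
  exists k' st',
    [/\ exec (compile c) st k' st', k' <= K * k & represents h' st'].
Proof.
elim=> {c h k h'} /=.
- move=> h i e ok leK st rep.
  have [k1 [st1 [x1 l1 kp1 v1]]] := compile_expr_correct ok 0 rep.
  have rep1 := represents_keeps rep kp1.
  exists (k1 + (1 + 1)); eexists; split.
  + by apply: exec_seq x1 (exec_seq (exec_const _ _ _) (exec_add _ _ _ _)).
  + by lia.
  + have := represents_keeps rep1 (keeps_set 0 st1 (ltnW (ltnSn 0) : 0 <= 1)).
    move=> /(represents_set_var i (eval h e)); congr represents; congr set_reg.
    by rewrite /= upd_same upd_other // v1 addn0.
- move=> h a e1 e2 /and3P[la ok1 ok2] leK st rep.
  have [k1 [st1 [x1 l1 kp1 v1]]] := compile_expr_correct ok1 0 rep.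
  have rep1 := represents_keeps rep kp1.
  have [st2 [x2 kp2 v2]] := cell_correct st1 0 a.
  have rep2 := represents_keeps rep1 kp2.
  have [k3 [st3 [x3 l3 kp3 v3]]] := compile_expr_correct ok2 1 rep2.
  have rep3 := represents_keeps rep2 (keepsS kp3).
  exists (k1 + (7 + (k3 + 1))); eexists; split.
  + apply: exec_seq x1 _; apply: exec_seq x2 _; apply: exec_seq x3 _.
    by constructor.
  + by lia.
  + have -> : reg st3 (tmp 0) = size input + 16 * eval h e1 + a.
      by case: kp3 => _ ->; rewrite // v2 v1; case: rep1 => ->.
    by rewrite v3; apply: represents_set_arr.
- move=> c1 c2 h0 h1 h2 k1 k2 _ IH1 _ IH2 /andP[ok1 ok2] leK st rep.
  have [||k1' [st1 [x1 l1 rep1]]] := IH1 _ _ st rep => //; first by lia.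
  have [||k2' [st2 [x2 l2 rep2]]] := IH2 _ _ st1 rep1 => //; first by lia.
  exists (k1' + k2'), st2; split=> //; first exact: exec_seq x1 x2.
  by rewrite mulnDr leq_add.
- move=> e c1 c2 h h' k pos _ IH /and3P[ok ok1 ok2] leK st rep.
  have [k1 [st1 [x1 l1 kp1 v1]]] := compile_expr_correct ok 0 rep.
  have rep1 := represents_keeps rep kp1.
  have [||k2 [st2 [x2 l2 rep2]]] := IH _ _ st1 rep1 => //; first by lia.
  exists (k1 + k2.+1), st2; split=> //; last by lia.
  by apply: exec_seq x1 _; apply: exec_if_true => //; rewrite v1.
- move=> e c1 c2 h h' k pos _ IH /and3P[ok ok1 ok2] leK st rep.
  have [k1 [st1 [x1 l1 kp1 v1]]] := compile_expr_correct ok 0 rep.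
  have rep1 := represents_keeps rep kp1.
  have [||k2 [st2 [x2 l2 rep2]]] := IH _ _ st1 rep1 => //; first by lia.
  exists (k1 + k2.+1), st2; split=> //; last by lia.
  by apply: exec_seq x1 _; apply: exec_if_false => //; rewrite v1.
- move=> e c h pos /andP[ok _] leK st rep.
  have [k1 [st1 [x1 l1 kp1 v1]]] := compile_expr_correct ok 0 rep.
  exists (k1 + 1), st1; split; [|by lia|exact: represents_keeps kp1].
  by apply: exec_seq x1 _; apply: exec_while_stop; rewrite v1.
- move=> e c h0 h1 h2 k1 k2 pos _ IH1 _ IH2 /andP[ok okc] leK st rep.
  have [k0' [st0 [x0 l0 kp0 v0]]] := compile_expr_correct ok 0 rep.
  have rep0 := represents_keeps rep kp0.
  have [||k1' [st1 [x1 l1 rep1]]] := IH1 _ _ st0 rep0 => //; first by lia.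
  have [||k2' [st2 [x2 l2 rep2]]] := IH2 _ _ st1 rep1 => //.
    by rewrite ok.
  (* The run of the remaining loop begins by evaluating the guard. Inside [While] that evaluation
     closes the current body, so it is split off and regrouped. *)
  inversion x2 as [| | | | | |? ? ? st' ? ke kw xe xw| | | |]; subst.
  exists (k0' + ((k1' + ke) + kw).+1), st2; split=> //; last by lia.
  apply: exec_seq x0 _; apply: exec_while_loop; rewrite ?v0 //; last exact: xw.
  exact: exec_seq x1 xe.
Qed.

(** * Program logic with step counts *)

Definition wp (c : com) (h : hstate) (Q : nat -> hstate -> Prop) : Prop :=
  exists k h', hexec c h k h' /\ Q k h'.

Fixpoint assigned (c : com) : seq nat :=
  match c with
  | Assign i _ => [:: i]
  | Put _ _ _ => [::]
  | Sequ c1 c2 | Cond _ c1 c2 => assigned c1 ++ assigned c2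
  | Loop _ c => assigned c
  end.

Fixpoint written (c : com) : seq nat :=
  match c with
  | Assign _ _ => [::]
  | Put a _ _ => [:: a]
  | Sequ c1 c2 | Cond _ c1 c2 => written c1 ++ written c2
  | Loop _ c => written c
  end.

Definition frame (c : com) (h h' : hstate) : Prop :=
  (forall i, i \notin assigned c -> var h' i = var h i) /\
  (forall a, a \notin written c -> arr h' a = arr h a).

Lemma frame_trans c c1 c2 h0 h1 h2 :
  {subset assigned c1 <= assigned c} -> {subset written c1 <= written c} ->
  {subset assigned c2 <= assigned c} -> {subset written c2 <= written c} ->
  frame c1 h0 h1 -> frame c2 h1 h2 -> frame c h0 h2.
Proof.
move=> s1 w1 s2 w2 [v1 a1] [v2 a2]; split=> i ni.
  by rewrite v2 ?v1 //; apply: contra ni; [apply: s1|apply: s2].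
by rewrite a2 ?a1 //; apply: contra ni; [apply: w1|apply: w2].
Qed.

Lemma hexec_frame c h k h' : hexec c h k h' -> frame c h h'.
Proof.
elim=> {c h k h'}.
- by move=> h i e; split=> //= j; rewrite inE => /negbTE->.
- by move=> h a e1 e2; split=> //= b; rewrite inE => /negbTE->.
- move=> c1 c2 h0 h1 h2 k1 k2 _ f1 _; apply: frame_trans f1 => i /=;
    by rewrite mem_cat => ->; rewrite ?orbT.
- move=> e c1 c2 h h' k _ _ [f1 f2]; split=> i /=; rewrite mem_cat negb_or;
    by case/andP=> ? ?; auto.
- move=> e c1 c2 h h' k _ _ [f1 f2]; split=> i /=; rewrite mem_cat negb_or;
    by case/andP=> ? ?; auto.
- by split.
- by move=> e c h0 h1 h2 k1 k2 _ _ f1 _ f2; apply: frame_trans f1 f2.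
Qed.

Lemma wp_use c h (P Q : nat -> hstate -> Prop) :
  wp c h P -> (forall k h', frame c h h' -> P k h' -> Q k h') -> wp c h Q.
Proof.
move=> [k [h' [x p]]] H; exists k, h'; split=> //; apply: H p.
exact: hexec_frame x.
Qed.

Lemma wp_assign i e h Q : Q 1 (set_var h i (eval h e)) -> wp (Assign i e) h Q.
Proof. by move=> q; eexists; eexists; split; [constructor|]. Qed.

Lemma wp_put a e1 e2 h Q :
  Q 1 (set_arr h a (eval h e1) (eval h e2)) -> wp (Put a e1 e2) h Q.
Proof. by move=> q; eexists; eexists; split; [constructor|]. Qed.

Lemma wp_sequ c1 c2 h Q :
  wp c1 h (fun k1 h1 => wp c2 h1 (fun k2 h2 => Q (k1 + k2) h2)) ->
  wp (Sequ c1 c2) h Q.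
Proof.
move=> [k1 [h1 [x1 [k2 [h2 [x2 q]]]]]]; exists (k1 + k2), h2; split=> //.
exact: hexec_sequ x1 x2.
Qed.

Lemma wp_cond e c1 c2 h Q :
  (0 < eval h e -> wp c1 h (fun k => Q k.+1)) ->
  (eval h e = 0 -> wp c2 h (fun k => Q k.+1)) -> wp (Cond e c1 c2) h Q.
Proof.
move=> H1 H2; have [e0|e0] := posnP (eval h e).
  have [k [h' [x q]]] := H2 e0; exists k.+1, h'.
  by split=> //; apply: hexec_cond_false.
have [k [h' [x q]]] := H1 e0; exists k.+1, h'.
by split=> //; apply: hexec_cond_true.
Qed.

(** The number [q] of completed rounds is carried by the invariant, and [S - q] is the variant. The
    bound [q < S] is asked for only while the guard holds, so it may be derived from the invariant
    and the guard together. *)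
Lemma wp_loop (I : nat -> hstate -> Prop) S T e c h Q :
  I 0 h ->
  (forall q h', I q h' -> 0 < eval h' e ->
     q < S /\ wp c h' (fun k h'' => k <= T /\ I q.+1 h'')) ->
  (forall q k h', k <= S * T.+1 + 1 -> eval h' e = 0 -> I q h' -> Q k h') ->
  wp (Loop e c) h Q.
Proof.
move=> I0 body fin.
suff gen f : forall q h, S - q = f -> I q h -> exists q' k h',
    [/\ hexec (Loop e c) h k h', k <= f * T.+1 + 1, eval h' e = 0 & I q' h'].
  have [q [k [h' [x lk e0 Iq]]]] := gen _ 0 h (subn0 S) I0.
  by exists k, h'; split=> //; apply: fin Iq.
elim: f => [|f IH] {I0 fin}q {}h def_f Iq.
  have [e0|e0] := posnP (eval h e); last by have [qS _] := body _ _ Iq e0; lia.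
  by exists q, 1, h; split; [exact: hexec_loop_stop|lia| |].
have [e0|e0] := posnP (eval h e).
  by exists q, 1, h; split; [exact: hexec_loop_stop|lia| |].
have [_ [k1 [h1 [x1 [lk1 Iq1]]]]] := body _ _ Iq e0.
have [|q2 [k2 [h2 [x2 lk2 e2 I2]]]] := IH q.+1 h1 _ Iq1; first by lia.
exists q2, (k1 + k2).+1, h2; split=> //; first exact: hexec_loop_go x1 x2.
by rewrite mulSn; lia.
Qed.

Definition For (i : nat) (e : expr) (c : com) : com :=
  Sequ (Assign i (Cst 0))
    (Loop (Minus e (Var i)) (Sequ c (Assign i (Plus (Var i) (Cst 1))))).

Fixpoint stable (e : expr) (c : com) : bool :=
  match e with
  | Cst _ => true
  | Var i => i \notin assigned c
  | Plus e1 e2 | Minus e1 e2 => stable e1 c && stable e2 c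
  | Get a e => (a \notin written c) && stable e c
  | Inp e => stable e c
  end.

Lemma stable_eval e c h h' : stable e c -> frame c h h' -> eval h' e = eval h e.
Proof.
move=> + [fv fa].
elim: e => [//|i|e1 IH1 e2 IH2|e1 IH1 e2 IH2|a e IH|e IH] /=.
- exact: fv.
- by case/andP=> /IH1-> /IH2->.
- by case/andP=> /IH1-> /IH2->.
- by case/andP=> na /IH->; rewrite fa.
- by move=> /IH->.
Qed.

Lemma wp_for (Inv : nat -> hstate -> Prop) N T i e c h Q :
  stable e (For i e c) -> i \notin assigned c ->
  eval h e = N -> Inv 0 (set_var h i 0) ->
  (forall j h', j < N -> frame (For i e c) h h' -> var h' i = j -> Inv j h' ->
     wp c h' (fun k h'' => k <= T /\ Inv j.+1 (set_var h'' i j.+1))) ->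
  (forall k h', k <= N * (T + 2) + 2 -> frame (For i e c) h h' ->
     var h' i = N -> Inv N h' -> Q k h') ->
  wp (For i e c) h Q.
Proof.
move=> st_e ni eN I0 body fin; apply/wp_sequ/wp_assign.
have frame0 : frame (For i e c) h (set_var h i (eval h (Cst 0))).
  by split=> //= j; rewrite inE negb_or => /andP[/negbTE->].
apply: (@wp_loop (fun j h' => [/\ j <= N, var h' i = j, Inv j h'
  & frame (For i e c) h h']) N T.+1).
- by split=> //=; rewrite eqxx.
- move=> j h' [lj vi Ij fr] /=; rewrite (stable_eval st_e fr) eN vi subn_gt0.
  move=> ljN; split=> //; apply: wp_sequ.
  apply: wp_use (body j h' ljN fr vi Ij) _ => k h'' fr' [lk IS].
  have vi' : var h'' i = j by case: fr' => -> //; rewrite ni.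
  apply: wp_assign.
  have -> : eval h'' (Plus (Var i) (Cst 1)) = j.+1 by rewrite /= vi' addn1.
  split; first by lia.
  split=> //; first by rewrite /= eqxx.
  case: fr fr' => [fv fa] [fv' fa']; split=> /= [l|a].
    rewrite inE mem_cat !negb_or => /and3P[/negbTE li lc ll].
    by rewrite li fv' ?fv //= inE mem_cat !negb_or li lc.
  rewrite mem_cat negb_or => /andP[ac _].
  by rewrite fa' ?fa //= cats0.
- move=> j k h' lk /= e0 [lj vi Ij fr].
  have jN : j = N.
    by move: e0; rewrite (stable_eval st_e fr) eN vi; lia.
  rewrite {}jN in lj vi Ij; apply: fin => //.
  by move: lk; rewrite [T + 2]addn2; lia.
Qed.

(** Registers and arrays are numbered by the phase that fixes them, so what later phases must
    preserve is an initial segment. Register 0 is exempt, as it receives the answer. *)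
Definition agree (r l : nat) (h h' : hstate) : Prop :=
  (forall i, 0 < i < r -> var h' i = var h i) /\
  (forall a, a < l -> arr h' a = arr h a).

Lemma frame_agree r l c h h' :
  all (fun i => ~~ (0 < i < r)) (assigned c) -> all (leq l) (written c) ->
  frame c h h' -> agree r l h h'.
Proof.
move=> /allP va /allP aa [fv fa]; split=> [i hi|a la].
  by apply: fv; apply/negP => /va; rewrite hi.
by apply: fa; apply/negP => /aa; rewrite leqNgt la.
Qed.

Lemma agree_trans r l h0 h1 h2 :
  agree r l h0 h1 -> agree r l h1 h2 -> agree r l h0 h2.
Proof.
by move=> [v1 a1] [v2 a2]; split=> i hi; rewrite ?v2 ?v1 ?a2 ?a1.
Qed.

Lemma agree_set_var r l h i v : ~~ (0 < i < r) -> agree r l h (set_var h i v).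
Proof. by move=> ni; split=> //= j hj; case: eqP => // ji; rewrite -ji hj in ni. Qed.

End Language.

(** * The search program *)

(** In the application [P] is [m ^ (2 * x)], [Y] the length of a vector, [M] the number of candidate
    times and [S] the number of possible vectors. Kept abstract, they leave an inequality between
    polynomials of fixed degree. *)
Lemma polynomial_bound n m x P S Y M c : 0 < n -> 0 < m -> 0 < x ->
  m * m <= P -> Y <= 2 * x -> M <= 4 * m -> S <= c * P ->
  7 * m + 16 * Y + 12 * n + Y * (4 * M + 7)
  + (M * (n * (n * (6 * Y + 6 + m * (5 * Y + 7) + 2) + 4) + 5) + 2)
  + (n * S * (n * (Y * (3 * Y + 9) + 13) + 8).+1 + 3 * Y + 14) + 60
  <= (800 + 120 * c) * (n ^ 3 * P * x ^ 2).
Proof.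
move=> n0 m0 x0 mP YB MB SB.
apply: (@leq_trans (7 * m + 16 * (2 * x) + 12 * n + (2 * x) * (4 * (4 * m) + 7)
  + ((4 * m) * (n * (n * (6 * (2 * x) + 6 + m * (5 * (2 * x) + 7) + 2) + 4) + 5) + 2)
  + (n * (c * P) * (n * ((2 * x) * (3 * (2 * x) + 9) + 13) + 8).+1
     + 3 * (2 * x) + 14) + 60)).
  by do ![exact: leqnn | eassumption | apply: leq_add | apply: leq_mul
         | rewrite ltnS].
have n1 : n <= n ^ 3 by rewrite -[leqLHS]expn1 leq_pexp2l.
have n2 : n * n <= n ^ 3 by rewrite -[n * n]/(n ^ 2) leq_pexp2l.
have n3 : 0 < n ^ 3 by rewrite expn_gt0 n0.
have x1 : x <= x ^ 2 by rewrite -[leqLHS]expn1 leq_pexp2l.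
have x2 : 0 < x ^ 2 by rewrite expn_gt0 x0.
have m1 : m <= P by apply: leq_trans mP; rewrite leq_pmulr.
have P0 : 0 < P by apply: leq_trans m1.
set W := n ^ 3 * P * x ^ 2.
(* Each monomial of the expanded left-hand side is a product of this kind, hence at most [W] or
   [c * W]. The coefficients sum to 363 and 52, well below 800 and 120. *)
have b a p q : a <= n ^ 3 -> p <= P -> q <= x ^ 2 -> a * p * q <= W.
  by move=> *; apply: leq_mul => //; apply: leq_mul.
have cb a p q : a <= n ^ 3 -> p <= P -> q <= x ^ 2 ->
    c * (a * p * q) <= c * W.
  by move=> *; apply: leq_mul => //; apply: b.
have := b 1 1 1 n3 P0 x2; have := b 1 m 1 n3 m1 x2; have := b 1 1 x n3 P0 x1.
have := b n 1 1 n1 P0 x2; have := b 1 m x n3 m1 x1.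
have := b (n * n) m x n2 m1 x1; have := b (n * n) m 1 n2 m1 x2.
have := b (n * n) (m * m) x n2 mP x1; have := b (n * n) (m * m) 1 n2 mP x2.
have := b n m 1 n1 m1 x2.
have := cb (n * n) P (x ^ 2) n2 (leqnn _) (leqnn _).
have := cb (n * n) P x n2 (leqnn _) x1.
have := cb (n * n) P 1 n2 (leqnn _) x2.
have := cb n P 1 n1 (leqnn _) x2.
move: W {b cb n1 n2 n3 x1 x2} => W; rewrite -[x ^ 2]/(x * x).
lia.
Qed.

Local Notation "a ;; b" := (Sequ a b) (at level 80, right associativity).
Local Notation "i <~ e" := (Assign i e) (at level 70).
Local Notation "e1 '+~' e2" := (Plus e1 e2) (at level 50, left associativity).
Local Notation "e1 '-~' e2" := (Minus e1 e2) (at level 50, left associativity).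

(* Registers: rX holds x + 1, rH the horizon and rN the number of candidate
   times; rhoff and rtoff are rhead and rtail multiplied by x + 1, so that they
   point into the array aQA of vectors. *)
Local Notation racc := 0 (only parsing).
Local Notation rn := 1 (only parsing).
Local Notation rm := 2 (only parsing).
Local Notation rs := 3 (only parsing).
Local Notation rz := 4 (only parsing).
Local Notation rx := 5 (only parsing).
Local Notation rd := 6 (only parsing).
Local Notation rX := 7 (only parsing).
Local Notation rH := 8 (only parsing).
Local Notation rN := 9 (only parsing).
Local Notation ri := 11 (only parsing).
Local Notation rt := 12 (only parsing).
Local Notation rj := 13 (only parsing).
Local Notation rv := 14 (only parsing).
Local Notation rw := 15 (only parsing).
Local Notation re := 16 (only parsing).
Local Notation rk := 17 (only parsing).
Local Notation rtau := 18 (only parsing).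
Local Notation rprev := 19 (only parsing).
Local Notation rold := 20 (only parsing).
Local Notation rb := 21 (only parsing).
Local Notation rhead := 22 (only parsing).
Local Notation rtail := 23 (only parsing).
Local Notation rhoff := 24 (only parsing).
Local Notation rtoff := 25 (only parsing).
Local Notation rcv := 26 (only parsing).
Local Notation rcode := 27 (only parsing).
Local Notation ry := 28 (only parsing).
Local Notation rval := 29 (only parsing).
Local Notation ru := 30 (only parsing).

(* Arrays: aW, aV, aK, aY and aC hold multiples, which replaces the missing
   multiplication instruction; aP gives the digits of the code of a state, aG
   the worst delayed arrivals, aQV and aQA the queue, aVis the visited codes. *)
Local Notation aT := 0 (only parsing).
Local Notation aW := 1 (only parsing).
Local Notation aV := 2 (only parsing).
Local Notation aK := 3 (only parsing).
Local Notation aY := 4 (only parsing).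
Local Notation aP := 5 (only parsing).
Local Notation aC := 6 (only parsing).
Local Notation aG := 7 (only parsing).
Local Notation aR := 8 (only parsing).
Local Notation aQV := 9 (only parsing).
Local Notation aQA := 10 (only parsing).
Local Notation aVis := 11 (only parsing).

Definition emax (a b : expr) : expr := a +~ (b -~ a).
Definition emin (a b : expr) : expr := a -~ (a -~ b).

Definition arc_field (f : nat) : expr :=
  Inp (Cst (6 + f) +~ ((Var re +~ Var re) +~ (Var re +~ Var re))).

Definition arc_arrival : expr := arc_field 2 +~ arc_field 3.

Definition load_header : com :=
  rn <~ Inp (Cst 0);; rm <~ Inp (Cst 1);; rs <~ Inp (Cst 2);;
  rz <~ Inp (Cst 3);; rx <~ emin (Inp (Cst 4)) (Var rm);; rd <~ Inp (Cst 5);;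
  rX <~ Var rx +~ Cst 1.

(** Slot 1 of [aT] is left free for the horizon, which is known only after all arcs have been
    read. *)
Definition list_times : com :=
  Put aT (Cst 0) (Cst 0);; rH <~ Cst 1;; rN <~ Cst 2;;
  For re (Var rm) (
    rb <~ arc_arrival;;
    Put aT (Var rN) (Var rb);;
    Put aT (Var rN +~ Cst 1) (Var rb +~ Var rd);;
    rN <~ Var rN +~ Cst 2;;
    rH <~ Var rH +~ Var rb +~ Var rd);;
  Put aT (Cst 1) (Var rH).

Definition tabulate (a len : nat) (step : expr) : com :=
  rt <~ Cst 0;; For ri (Var len) (Put a (Var ri) (Var rt);; rt <~ Var rt +~ step).

(** After [tabulate], [rt] holds the product of length and step, so each table supplies the radix
    weight of the next. *)
Definition tabulate_offsets : com :=
  tabulate aY rX (Var rH +~ Cst 1);;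
  tabulate aW rn (Var rH +~ Cst 1);;
  ru <~ Var rt;; tabulate aV rn (Var ru);;
  ru <~ Var rt;; tabulate aK rX (Var ru).

Definition tabulate_codes : com :=
  ru <~ Cst 1;;
  For ry (Var rX) (
    rt <~ Cst 0;;
    For rj (Var rN) (
      Put aP (Get aY (Var ry) +~ Get aT (Var rj)) (Var rt);;
      rt <~ Var rt +~ Var ru);;
    ru <~ Var rt);;
  tabulate aC rn (Var ru).

Definition distance (a b : expr) : expr := (a -~ b) +~ (b -~ a).

(* The assignments to scratch registers in the first branch of Cond below, in
   enqueue and in search stand for a no-op. *)
Definition fill_row : com :=
  For rk (Var rX) (Put aR (Var rk) (Var rH));;
  For re (Var rm) (
    Cond (distance (arc_field 0) (Var rv) +~ distance (arc_field 1) (Var rw)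
          +~ (Var rtau -~ arc_field 2))
      (rb <~ Cst 0)
      (rb <~ arc_arrival;;
       rprev <~ Cst 0;;
       For rk (Var rX) (
         rold <~ Get aR (Var rk);;
         Put aR (Var rk) (emax (emin (Var rb) (Var rold))
                               (emin (Var rb +~ Var rd) (Var rprev)));;
         rprev <~ Var rold))).

Definition fill_worst : com :=
  For rj (Var rN) (
    rtau <~ Get aT (Var rj);;
    For rv (Var rn) (
      For rw (Var rn) (
        fill_row;;
        For rk (Var rX) (
          Put aG (Get aK (Var rk) +~ Get aV (Var rv) +~ Get aW (Var rw)
                  +~ Var rtau) (Get aR (Var rk)))))).

(** The candidate vector already lies in the first free slot of [aQA]. Accepting it only advances
    the tail; a rejected one is overwritten by the next candidate. *)
Definition enqueue : com :=
  rcode <~ Get aC (Var rcv);;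
  For ry (Var rX) (
    rcode <~ Var rcode +~
      Get aP (Get aY (Var ry) +~ Get aQA (Var rtoff +~ Var ry)));;
  Cond (Get aVis (Var rcode))
    (rval <~ Cst 0)
    (Put aVis (Var rcode) (Cst 1);;
     Put aQV (Var rtail) (Var rcv);;
     rtail <~ Var rtail +~ Cst 1;;
     rtoff <~ Var rtoff +~ Var rX).

Definition extend : com :=
  For ry (Var rX) (
    rval <~ Cst 0;;
    For rk (Var ry +~ Cst 1) (
      rval <~ emax (Var rval)
        (Get aG (Get aK (Var rk) +~ Get aV (Var rv) +~ Get aW (Var rw)
                 +~ Get aQA (Var rhoff +~ (Var ry -~ Var rk)))));;
    Put aQA (Var rtoff +~ Var ry) (Var rval)).

(** The vector of the empty route is zero, and so is untouched memory; hence the start is enqueued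
    without writing a vector. *)
Definition search : com :=
  rtail <~ Cst 0;; rtoff <~ Cst 0;; rhead <~ Cst 0;; rhoff <~ Cst 0;;
  rcv <~ Var rs;; enqueue;;
  Loop (Var rtail -~ Var rhead) (
    rv <~ Get aQV (Var rhead);;
    For rw (Var rn) (extend;; rcv <~ Var rw;; enqueue);;
    Cond (distance (Var rv) (Var rz)
          +~ (Get aQA (Var rhoff +~ Var rx) +~ Cst 1 -~ Var rH))
      (rval <~ Cst 0)
      (racc <~ Cst 1);;
    rhead <~ Var rhead +~ Cst 1;;
    rhoff <~ Var rhoff +~ Var rX).

Definition program : com :=
  load_header;; list_times;; tabulate_offsets;; tabulate_codes;; fill_worst;;
  search.

Lemma program_ok : com_ok program.
Proof. by []. Qed.

(** * Correctness of the precomputed tables *)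

Section Correctness.
Variables (n : nat) (es : seq (time_arc 'I_n)) (s z : 'I_n) (x0 d : nat).
Let input := encode es s z x0 d.
Let m := size es.
Let x := minn x0 m.
Let X := x.+1.
Let N := 2 * m + 2.

(** Any number above all delayed arrivals would do; a running sum needs no comparison. *)
Definition horizon := (\sum_(e <- es) (arrival e + d)).+1.
Let H := horizon.

Definition times : seq nat :=
  [:: 0; H] ++ flatten [seq [:: arrival e; arrival e + d] | e <- es].

Let T j := nth 0 times j.

Lemma size_times : size times = N.
Proof.
rewrite /times size_cat size_flatten /shape -map_comp /=.
rewrite (eq_map (g := fun=> 2)) // sumnE big_map.
by rewrite big_const_seq count_predT iter_addn addn0 /N addnC.
Qed.

Local Notation wp := (wp input).

Record header (h : hstate) : Prop := Header {
  header_n : var h rn = n;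
  header_m : var h rm = m;
  header_s : var h rs = s;
  header_z : var h rz = z;
  header_x : var h rx = x;
  header_d : var h rd = d;
  header_X : var h rX = X }.

Lemma header_agree r l h h' : 8 <= r -> agree r l h h' -> header h -> header h'.
Proof.
move=> lr [v _] [*]; split; rewrite v // (leq_trans _ lr) //.
Qed.

Lemma load_header_spec h : wp load_header h (fun k h' =>
  [/\ k <= 7, header h', var h' 0 = var h 0 & arr h' = arr h]).
Proof.
do 6 !(apply: wp_sequ; apply: wp_assign). apply: wp_assign.
by split=> //; split=> //=; rewrite -minnE ?addn1.
Qed.

Ltac use_frame F :=
  match type of F with frame _ ?h ?h' =>
    repeat match goal with
    | |- context [var h' ?i] => rewrite (proj1 F i isT)
    | |- context [arr h' ?a] => rewrite (proj2 F a isT)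
    end
  end.

Lemma nth_flatten_map (A B : Type) (a0 : A) (b0 : B) (f : A -> seq B) c l j r :
  (forall a, size (f a) = c) -> j < size l -> r < c ->
  nth b0 (flatten (map f l)) (j * c + r) = nth b0 (f (nth a0 l j)) r.
Proof.
move=> sz; elim: l j => [//|a l IH] [|j] /=; rewrite nth_cat sz.
  by move=> _ ->.
move=> lj lr; rewrite ifF; last by rewrite mulSn; lia.
by rewrite mulSn -addnA addKn IH.
Qed.

Let e0 : time_arc 'I_n := (s, s, 0, 0).
Let arc j := nth e0 es j.

Lemma eval_arc_field h f : var h re < m -> f < 4 ->
  eval input h (arc_field f) = nth 0 (encode_arc (arc (var h re))) f.
Proof.
move=> lj lf; rewrite -(nth_flatten_map e0 0 (c := 4)) //.
transitivity (nth 0 input (6 + (var h re * 4 + f))).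
  by congr nth; rewrite /=; lia.
by rewrite /input /encode nth_cat ltnNge leq_addr addKn.
Qed.

Lemma eval_arc_arrival h : var h re < m ->
  eval input h arc_arrival = arrival (arc (var h re)).
Proof.
move=> lj; rewrite -[LHS]/(eval input h (arc_field 2) + eval input h (arc_field 3)).
by rewrite !eval_arc_field.
Qed.

Record timed (h : hstate) : Prop := Timed {
  timed_H : var h rH = H;
  timed_N : var h rN = N;
  timed_T : forall j, j < N -> arr h aT j = T j }.

Lemma timed_agree r l h h' : 10 <= r -> 1 <= l -> agree r l h h' ->
  timed h -> timed h'.
Proof.
move=> lr ll [v a] [? ? t]; split=> [| |j lj];
  by rewrite ?v ?a ?t // (leq_trans _ lr).
Qed.

Lemma take_arcS j : j < m -> take j.+1 es = rcons (take j es) (arc j).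
Proof. by move=> lj; rewrite (take_nth e0). Qed.

Lemma list_times_spec h : header h -> wp list_times h (fun k h' =>
  k <= m * 7 + 6 /\ timed h').
Proof.
move=> hd; apply: wp_sequ; apply: wp_put; apply: wp_sequ; apply: wp_assign.
apply: wp_sequ; apply: wp_assign; set h1 := set_var _ _ _.
pose Inv j h' := [/\ var h' rN = 2 * j + 2,
  var h' rH = (\sum_(e <- take j es) (arrival e + d)).+1, arr h' aT 0 = 0
  & forall i, i < 2 * j -> arr h' aT (i + 2) = T (i + 2)].
apply: wp_sequ.
apply: (@wp_for _ Inv m 5) => //; first by rewrite /= (header_m hd).
- by split=> //; rewrite take0 big_nil.
- move=> j h' lj F vj [vN vH v0 vT].
  have vd : var h' rd = d by use_frame F; rewrite -(header_d hd).
  apply: wp_sequ; apply: wp_assign; apply: wp_sequ; apply: wp_put.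
  apply: wp_sequ; apply: wp_put; apply: wp_sequ; apply: wp_assign.
  apply: wp_assign; rewrite eval_arc_arrival vj //.
  split=> //; split=> /=; rewrite ?vN ?vH ?vd //.
  + by lia.
  + by rewrite take_arcS // big_rcons /=; lia.
  + by rewrite !ifF ?v0 //; lia.
  + move=> i li.
    have tE r : r < 2 -> T (j * 2 + r + 2) = nth 0 [:: arrival (arc j); arrival (arc j) + d] r.
      move=> lr; rewrite /T addn2 /=; exact: (nth_flatten_map e0).
    case: (ltnP i (2 * j)) => li2; first by rewrite !ifF ?vT //; lia.
    have [->|->] : i = 2 * j \/ i = 2 * j + 1 by lia.
      by rewrite ifF ?eqxx; [rewrite -[2 * j]addn0 mulnC tE|lia].
    by rewrite ifT; [rewrite [2 * j]mulnC tE|lia].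
- move=> k h' lk F vj [vN vH v0 vT]; apply: wp_put; split; first by lia.
  rewrite take_size in vH.
  split=> //= i li; rewrite vH; case: eqP => [->//|i1].
  case: i => [|[|i]] // in li i1 *; rewrite -addn2 vT //; lia.
Qed.

(** The range of [len] keeps it apart from the registers 11 and 12, which the loop overwrites. *)
Lemma tabulate_spec a len step h L S :
  0 < len < 11 -> var h len = L ->
  (forall h', (forall i, i \notin [:: ri; rt] -> var h' i = var h i) ->
     eval input h' step = S) ->
  wp (tabulate a len step) h (fun k h' =>
    [/\ k <= L * 4 + 3, forall i, i < L -> arr h' a i = i * S
      & var h' rt = L * S]).
Proof.
move=> ll vL eS; apply: wp_sequ; apply: wp_assign.
have l1 : (len == 11) = false by lia.
have l2 : (len == 12) = false by lia.
apply: (@wp_for _ (fun j h' => (forall i, i < j -> arr h' a i = i * S) /\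
  var h' rt = j * S) L 2) => //=.
- by rewrite !inE l1 l2.
- by rewrite l2.
- move=> j h' lj F vj [aS vt]; apply: wp_sequ; apply: wp_put.
  apply: wp_assign; rewrite /= eqxx vj vt; split=> //; split=> [i|].
    rewrite ltnS leq_eqVlt; case: eqP => [->//|_ /= li].
    by rewrite aS.
  rewrite mulSn addnC eS // => i; rewrite !inE negb_or => /andP[/negbTE n1 n2].
  by rewrite (proj1 F) /= ?n1 ?(negbTE n2) // !inE n1 (negbTE n2).
- move=> k h' lk F _ [aS vt]; split=> //; lia.
Qed.

Let B := H.+1.

Record offsets (h : hstate) : Prop := Offsets {
  offset_W : forall i, i < n -> arr h aW i = i * B;
  offset_V : forall i, i < n -> arr h aV i = i * (n * B);
  offset_K : forall i, i < X -> arr h aK i = i * (n * (n * B));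
  offset_Y : forall i, i < X -> arr h aY i = i * B }.

Lemma offsets_agree r l h h' : 5 <= l -> agree r l h h' ->
  offsets h -> offsets h'.
Proof.
by move=> ll [v a] [*]; split=> i li; rewrite ?a ?(leq_trans _ ll) //; auto.
Qed.

Lemma tabulate_offsets_spec h : header h -> timed h ->
  wp tabulate_offsets h (fun k h' =>
    k <= 8 * n + 8 * X + 14 /\ offsets h').
Proof.
move=> hd tm.
have [v1 v7 v8] : [/\ var h 1 = n, var h 7 = X & var h 8 = H].
  by rewrite (header_n hd) (header_X hd) (timed_H tm).
apply: wp_sequ; apply: wp_use.
  apply: (@tabulate_spec _ _ _ _ X B) => // h' hh /=.
  by rewrite hh // v8 addn1.
move=> k1 h1 F1 [lk1 a1 t1]; apply: wp_sequ; apply: wp_use.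
  apply: (@tabulate_spec _ _ _ _ n B) => // [|h' hh /=]; use_frame F1 => //.
  by rewrite hh // (proj1 F1) // v8 addn1.
move=> k2 h2 F2 [lk2 a2 t2]; apply: wp_sequ; apply: wp_assign.
apply: wp_sequ; apply: wp_use.
  apply: (@tabulate_spec _ _ _ _ n (n * B)) => // [|h' hh /=].
    by rewrite /=; use_frame F2; use_frame F1.
  by rewrite hh //= t2.
move=> k3 h3 F3 [lk3 a3 t3]; apply: wp_sequ; apply: wp_assign.
apply: wp_use.
  apply: (@tabulate_spec _ _ _ _ X (n * (n * B))) => // [|h' hh /=].
    by rewrite /=; use_frame F3; rewrite /=; use_frame F2; use_frame F1.
  by rewrite hh //= t3.
move=> k4 h4 F4 [lk4 a4 t4]; split; first by lia.
split=> i li; first 1 [idtac] || idtac.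
- use_frame F4; rewrite /=; use_frame F3; rewrite /=; exact: a2.
- use_frame F4; rewrite /=; exact: a3.
- exact: a4.
- use_frame F4; rewrite /=; use_frame F3; rewrite /=; use_frame F2; exact: a1.
Qed.

(** Times may be listed repeatedly. The last position wins, as in a loop that overwrites earlier
    entries, and the value 0 for an absent time matches an unwritten cell. *)
Fixpoint rank (j t : nat) : nat :=
  if j is j'.+1 then (if T j' == t then j' else rank j' t) else 0.

Lemma rank_lt j t : 0 < j -> rank j t < j.
Proof.
elim: j => //= j IH _; case: ifP => // _; case: j IH => // j IH.
by rewrite ltnS (ltnW (IH _)).
Qed.

Lemma T_rank t : t \in times -> T (rank N t) = t.
Proof.
have gen j i : i < j -> T (rank j (T i)) = T i.
  elim: j => [//|j IH]; rewrite ltnS leq_eqVlt [rank _ _]/=.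
  case: (i =P j) => [-> _|_ /= /IH IHi]; first by rewrite eqxx.
  by case: eqP.
move=> tin; rewrite -[t in LHS](nth_index 0 tin) gen; first exact: nth_index.
by rewrite -size_times index_mem.
Qed.

Record coded (h : hstate) : Prop := Coded {
  coded_P : forall y t, y < X -> t < B -> arr h aP (y * B + t) = rank N t * N ^ y;
  coded_C : forall v, v < n -> arr h aC v = v * N ^ X }.

Lemma coded_agree r l h h' : 7 <= l -> agree r l h h' -> coded h -> coded h'.
Proof.
move=> ll [v a] [cP cC].
by split=> *; rewrite ?a ?(leq_trans _ ll) //; auto.
Qed.

Lemma horizon_gt e : e \in es -> arrival e + d < H.
Proof. by move=> ein; rewrite ltnS (big_rem e ein) /= leq_addr. Qed.

Lemma times_lt t : t \in times -> t < B.
Proof.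
rewrite /times mem_cat !inE => /orP[/orP[]/eqP->//|/flattenP[l /mapP[e ein ->]]].
have := horizon_gt ein; rewrite !inE /B => lt /orP[]/eqP->; lia.
Qed.

(** Iterated, this uniqueness of quotient and remainder separates all mixed-radix addresses and
    codes. *)
Lemma pair_inj b y t y' t' : t < b -> t' < b ->
  (y * b + t == y' * b + t') = (y == y') && (t == t').
Proof.
move=> lt lt'; apply/eqP/andP => [eq|[/eqP-> /eqP->]//].
have b0 : 0 < b by lia.
have := congr1 (divn^~ b) eq; have := congr1 (modn^~ b) eq.
by rewrite !modnMDl !modn_small // !divnMDl // !divn_small // !addn0 => -> ->.
Qed.

Lemma tabulate_codes_spec h : header h -> timed h -> offsets h ->
  arr h aP = (fun=> 0) ->
  wp tabulate_codes h (fun k h' =>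
    k <= X * (4 * N + 7) + 4 * n + 6 /\ coded h').
Proof.
move=> hd tm os P0; apply: wp_sequ; apply: wp_assign; apply: wp_sequ.
apply: (@wp_for _ (fun y h' => var h' ru = N ^ y /\
  (forall y' t, t < B -> arr h' aP (y' * B + t) =
     if y' < y then rank N t * N ^ y' else 0)) X (4 * N + 5)) => //=.
- exact: header_X hd.
- by split=> // y' t _; rewrite P0.
- move=> y h1 ly F1 vy [vu aP1]; apply: wp_sequ; apply: wp_assign.
  apply: wp_sequ.
  apply: (@wp_for _ (fun j h' => var h' rt = j * N ^ y /\
    (forall y' t, t < B -> arr h' aP (y' * B + t) =
       if y' < y then rank N t * N ^ y'
       else if y' == y then rank j t * N ^ y else 0)) N 2) => //=.
  + by use_frame F1; rewrite /= (timed_N tm).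
  + split=> // y' t lt; rewrite aP1 //=; case: ifP => // _.
    by case: ifP.
  + move=> j h2 lj F2 vj [vt aP2]; apply: wp_sequ; apply: wp_put.
    apply: wp_assign; rewrite /= vt vj.
    have -> : var h2 ru = N ^ y by use_frame F2.
    have -> : var h2 ry = y by use_frame F2.
    have -> : arr h2 aY y = y * B by use_frame F2; rewrite /=; use_frame F1; apply: (offset_Y os).
    have -> : arr h2 aT j = T j by use_frame F2; rewrite /=; use_frame F1; apply: (timed_T tm).
    split=> //; split; first by rewrite mulSn addnC.
    move=> y' t lt; have lT : T j < B.
      by apply: times_lt; rewrite mem_nth // size_times.
    rewrite pair_inj // [t == _]eq_sym; case: (y' =P y) => [->|ny] /=; last first.
      by rewrite aP2 //; move/eqP/negbTE: ny => ->.
    by rewrite ltnn; case: ifP => // _; rewrite aP2 // ltnn eqxx.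
  + move=> k h2 lk F2 _ [vt aP2]; apply: wp_assign; split; first by lia.
    split; first by rewrite /= vt expnS.
    move=> y' t lt; rewrite /= aP2 // ltnS.
    by case: (ltngtP y' y) => // ->.
- move=> k h1 lk F1 _ [vu aP1]; apply: wp_use.
    apply: (@tabulate_spec _ _ _ _ n (N ^ X)) => // [|h' hh /=].
      by use_frame F1; rewrite /= (header_n hd).
    by rewrite hh.
  move=> k' h2 F2 [lk2 a2 _]; split; first by lia.
  split=> [y t ly lt|v lv]; last exact: a2.
  by use_frame F2; rewrite aP1 // ly.
Qed.

Local Notation worstd := (worst d H).

Lemma usableE t v w (e : time_arc (ordinal n)) :
  usable t v w e =
  ((src e - v + (v - src e)) + (dst e - w + (w - dst e)) + (t - label e) == 0).
Proof.
rewrite /usable !addn_eq0 !subn_eq0 -!eqn_leq.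
by rewrite andbA.
Qed.

Lemma fill_row_spec h t v w : header h -> timed h ->
  var h rv = v -> var h rw = w -> var h rtau = t ->
  wp fill_row h (fun k h' =>
    k <= 3 * X + 4 + m * (5 * X + 7) /\
    forall i, i < X -> arr h' aR i = worstd es t v w i).
Proof.
move=> hd tm hv hw ht; apply: wp_sequ.
apply: (@wp_for _ (fun j h' => forall i, i < j -> arr h' aR i = H) X 1) => //.
- exact: header_X hd.
- move=> j h1 lj F1 vj a1; apply: wp_put; split=> // i /=; rewrite vj => li.
  case: eqP => [_|ni]; last by apply: a1; lia.
  by use_frame F1; rewrite /= (timed_H tm).
move=> k1 h1 lk1 F1 _ a1.
apply: (@wp_for _ (fun j h' => forall i, i < X ->
  arr h' aR i = worstd (take j es) t v w i) m (5 * X + 5)) => //.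
- by rewrite /=; use_frame F1; rewrite /= (header_m hd).
- by move=> i li; rewrite take0 a1.
- move=> j h2 lj F2 vj a2.
  have [vd vX] : var h2 rd = d /\ var h2 rX = X.
    by split; use_frame F2; rewrite /=; use_frame F1;
      rewrite /= ?(header_d hd) ?(header_X hd).
  have condE : (eval input h2 (distance (arc_field 0) (Var rv) +~
      distance (arc_field 1) (Var rw) +~ (Var rtau -~ arc_field 2)) == 0) =
      usable t v w (arc j).
    have fE f : f < 4 ->
        eval input h2 (arc_field f) = nth 0 (encode_arc (arc j)) f.
      by move=> lf; rewrite eval_arc_field ?vj.
    have [v2 w2 t2] : [/\ var h2 rv = v, var h2 rw = w & var h2 rtau = t].
      by rewrite -hv -hw -ht; split; use_frame F2; rewrite /=; use_frame F1.
    rewrite usableE -v2 -w2 -t2.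
    have := fE 0 isT; have := fE 1 isT; have := fE 2 isT.
    by rewrite [LHS]/(eval _ _ _) /= => -> -> ->.
  apply: wp_cond => [|/eqP]; rewrite ?lt0n condE => us.
    apply: wp_assign; split; first by lia.
    move=> i li; rewrite take_arcS // worst_rcons (negbTE us); exact: a2.
  apply: wp_sequ; apply: wp_assign; apply: wp_sequ; apply: wp_assign.
  rewrite eval_arc_arrival vj //; set r := worstd (take j es) t v w in a2.
  (* The row is updated in place: [rprev] saves the old entry [k - 1], and its initial 0 is the 0 of
     [absorb] for an empty budget. *)
  apply: (@wp_for _ (fun k h' => var h' rprev = (if k is k'.+1 then r k' else 0)
    /\ forall i, i < X -> arr h' aR i =
         if i < k then absorb d (arrival (arc j)) r i else r i) X 3) => //.
  + move=> k h3 lk F3 vk [vp a3].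
    apply: wp_sequ; apply: wp_assign; apply: wp_sequ; apply: wp_put.
    apply: wp_assign; split=> //; split=> [|i li] /=; rewrite vk a3 // ?ltnn //.
    have -> : var h3 rb = arrival (arc j) by use_frame F3.
    have -> : var h3 rd = d by use_frame F3.
    rewrite vp -maxnE -!minnE; case: eqP => [->|nik]; first by rewrite ltnSn.
    by rewrite a3 // ltnS; case: (ltngtP i k) nik.
  + move=> k h3 lk F3 _ [_ a3]; split; first by lia.
    by move=> i li; rewrite /= a3 // li take_arcS // worst_rcons us.
- move=> k h2 lk F2 _ a2; split; first by lia.
  by move=> i li; rewrite a2 // take_size.
Qed.

(** The last digit is the time itself rather than its position in [times], so a lookup needs no
    search. *)
Definition cell4 (k v w t : nat) : nat :=
  k * (n * (n * B)) + v * (n * B) + w * B + t.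

Lemma cell4_inj k v w t k' v' w' t' : v < n -> w < n -> t < B ->
  v' < n -> w' < n -> t' < B ->
  cell4 k v w t = cell4 k' v' w' t' -> [/\ k = k', v = v', w = w' & t = t'].
Proof.
have cE k1 v1 w1 t1 : cell4 k1 v1 w1 t1 = ((k1 * n + v1) * n + w1) * B + t1.
  by rewrite /cell4 !mulnDl !mulnA.
move=> lv lw lt lv' lw' lt' /eqP; rewrite !cE !pair_inj //.
by move=> /andP[/andP[/andP[/eqP-> /eqP->] /eqP->] /eqP->].
Qed.

Definition tabled (h : hstate) : Prop := forall k v w t,
  k < X -> v < n -> w < n -> t \in times ->
  arr h aG (cell4 k v w t) = worstd es t v w k.

(** The order in which the four nested loops fill the table. *)
Definition lex4 (j v w k j' v' w' k' : nat) : bool :=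
  [|| j' < j | (j' == j) && [|| v' < v | (v' == v) &&
    [|| w' < w | (w' == w) && (k' < k)]]].

Definition tabled_upto j v w k h : Prop := forall j' v' w' k',
  j' < N -> v' < n -> w' < n -> k' < X -> lex4 j v w k j' v' w' k' ->
  arr h aG (cell4 k' v' w' (T j')) = worstd es (T j') v' w' k'.

Lemma T_in j : j < N -> T j \in times.
Proof. by move=> lj; rewrite mem_nth // size_times. Qed.

(** Two positions may carry the same time, so a write can hit a cell that is already filled; it then
    stores the same value, which depends on the time alone. *)
Lemma tabled_upto_put j v w k h : j < N -> v < n -> w < n -> k < X ->
  tabled_upto j v w k h ->
  tabled_upto j v w k.+1
    (set_arr h aG (cell4 k v w (T j)) (worstd es (T j) v w k)).
Proof.
move=> lj lv lw lk up j' v' w' k' lj' lv' lw' lk' lex /=; case: eqP => [eqc|neq].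
  have [||||||-> -> -> ->//] := cell4_inj _ _ _ _ _ _ eqc;
    by rewrite ?times_lt ?T_in.
apply: up => //; case kk: (lex4 j v w k j' v' w' k') => //; case: neq.
suff [-> [-> [-> ->]]] : j' = j /\ v' = v /\ w' = w /\ k' = k by [].
by move: lex kk; rewrite /lex4; lia.
Qed.

Lemma tabled_upto_leq j v w k j1 v1 w1 k1 h h1 :
  (forall j' v' w' k', j' < N -> v' < n -> w' < n -> k' < X ->
     lex4 j1 v1 w1 k1 j' v' w' k' -> lex4 j v w k j' v' w' k') ->
  arr h1 aG = arr h aG -> tabled_upto j v w k h -> tabled_upto j1 v1 w1 k1 h1.
Proof.
move=> imp eqG up j' v' w' k' lj lv lw lk lex; rewrite eqG.
by apply: up => //; apply: imp.
Qed.

Definition row_time := 6 * X + 6 + m * (5 * X + 7).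
Definition fill_time := N * (n * (n * (row_time + 2) + 4) + 5) + 2.

Lemma fill_worst_spec h : header h -> timed h -> offsets h ->
  wp fill_worst h (fun k h' => k <= fill_time /\ tabled h').
Proof.
move=> hd tm os.
apply: (@wp_for _ (fun j => tabled_upto j 0 0 0) N
  (n * (n * (row_time + 2) + 4) + 3)) => //; first exact: timed_N tm.
- by move=> j' v' w' k' _ _ _ _; rewrite /lex4; lia.
- move=> j h1 lj F1 vj up1; apply: wp_sequ; apply: wp_assign.
  have vT : eval input h1 (Get aT (Var rj)) = T j.
    by rewrite /= vj; use_frame F1; rewrite /= (timed_T tm).
  rewrite vT.
  apply: (@wp_for _ (fun v => tabled_upto j v 0 0) n (n * (row_time + 2) + 2)) => //.
  + by rewrite /=; use_frame F1; rewrite /= (header_n hd).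
  + move=> v h2 lv F2 vv up2.
    apply: (@wp_for _ (fun w => tabled_upto j v w 0) n row_time) => //.
    * by rewrite /=; use_frame F2; rewrite /=; use_frame F1; rewrite /= (header_n hd).
    * move=> w h3 lw F3 vw up3; apply: wp_sequ.
      have ag : agree 11 7 h h3.
        apply: (@agree_trans _ _ _ h2); last by apply: frame_agree F3.
        apply: (@agree_trans _ _ _ (set_var h1 rtau (T j))).
          apply: (@agree_trans _ _ _ h1); first by apply: frame_agree F1.
          exact: agree_set_var.
        by apply: frame_agree F2.
      have hd3 := header_agree (isT : 8 <= 11) ag hd.
      have tm3 := timed_agree (isT : 10 <= 11) (isT : 1 <= 7) ag tm.
      have os3 := offsets_agree (isT : 5 <= 7) ag os.
      have vv3 : var h3 rv = v by use_frame F3.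
      have vt3 : var h3 rtau = T j by use_frame F3; rewrite /=; use_frame F2.
      apply: wp_use; first exact: (@fill_row_spec h3 (T j) v w).
      move=> k4 h4 F4 [lk4 a4].
      apply: (@wp_for _ (fun k => tabled_upto j v w k) X 1) => //.
      - by rewrite /=; use_frame F4; exact: header_X hd3.
      - by apply: tabled_upto_leq up3 => //=; use_frame F4.
      - move=> k h5 lk F5 vk up5; apply: wp_put; split=> //.
        have -> : eval input h5 (Get aK (Var rk) +~ Get aV (Var rv) +~
            Get aW (Var rw) +~ Var rtau) = cell4 k v w (T j).
          rewrite /= vk; use_frame F5; rewrite /=; use_frame F4.
          by rewrite vv3 vw vt3 (offset_K os3) // (offset_V os3) // (offset_W os3).
        have -> : eval input h5 (Get aR (Var rk)) = worstd es (T j) v w k.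
          by rewrite /= vk; use_frame F5; exact: a4.
        apply: tabled_upto_leq (tabled_upto_put lj lv lw lk up5) => //.
      - move=> k h5 lk F5 _ up5; split; first by rewrite /row_time; lia.
        by apply: tabled_upto_leq up5 => //; rewrite /lex4; lia.
    * move=> k h3 lk F3 _ up3; split; first by lia.
      by apply: tabled_upto_leq up3 => //; rewrite /lex4; lia.
  + move=> k h2 lk F2 _ up2; split; first by lia.
    by apply: tabled_upto_leq up2 => //; rewrite /lex4; lia.
- move=> k h1 lk F1 _ up1; split; first by rewrite /fill_time; lia.
  move=> k' v w t lk' lv lw tin; rewrite -(T_rank tin) up1 ?rank_lt //.
    by rewrite /N addn2.
  by rewrite /lex4 rank_lt // /N addn2.
Qed.

(** * Search over the codes of route prefixes *)

Definition globals (h : hstate) : Prop :=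
  [/\ header h, timed h, offsets h, coded h & tabled h].

Lemma globals_agree h h' : agree 10 8 h h' -> globals h -> globals h'.
Proof.
move=> ag [hd tm os cd tb]; split.
- exact: header_agree ag hd.
- exact: timed_agree ag tm.
- exact: offsets_agree ag os.
- exact: coded_agree ag cd.
- by case: ag => _ a k v w t *; rewrite a // tb.
Qed.

Lemma globals_set h i v : ~~ (0 < i < 10) -> globals h -> globals (set_var h i v).
Proof. by move=> ni; apply/globals_agree/agree_set_var. Qed.

Local Notation WA := (worst_arrive es d H s).

Lemma maxn_in a b : a \in times -> b \in times -> maxn a b \in times.
Proof. by rewrite /maxn; case: ifP. Qed.

Lemma minn_in a b : a \in times -> b \in times -> minn a b \in times.
Proof. by rewrite /minn; case: ifP. Qed.

Lemma worst_in t v w k : worstd es t v w k \in times.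
Proof.
have Hin : H \in times by rewrite !inE eqxx orbT.
have arc_in e : e \in es -> (arrival e \in times) && (arrival e + d \in times).
  move=> ein; rewrite /times !mem_cat; apply/andP; split; apply/orP; right;
    apply/flattenP; exists [:: arrival e; arrival e + d];
    by rewrite ?inE ?eqxx ?orbT //; apply/mapP; exists e.
have : {subset es <= es} by [].
(* The induction runs over the list being folded, while [times] and [H] keep referring to all of
   [es]. *)
move: {1 3}es => l; elim/last_ind: l k => [//|l e IH] k sub.
have {}IH i : worstd l t v w i \in times.
  by apply: IH => e' e'l; apply: sub; rewrite mem_rcons inE e'l orbT.
have /andP[bin bdin] : (arrival e \in times) && (arrival e + d \in times).
  by apply/arc_in/sub; rewrite mem_rcons inE eqxx.
rewrite worst_rcons; case: ifP => // _.
have [->|[k' _ ->]] := absorb_cases d (arrival e) (worstd l t v w) k;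
  exact: minn_in.
Qed.

Lemma WA_in p y : (WA p).2 y \in times.
Proof.
case/lastP: p => [//|p w]; rewrite worst_arrive_rcons /= /next.
apply: (big_ind (fun t => t \in times)) => // [a b|k _].
  exact: maxn_in.
exact: worst_in.
Qed.

Lemma WA_lt p : (WA p).1 < n.
Proof. by rewrite worst_arrive1. Qed.

Definition code p : nat :=
  (WA p).1 * N ^ X + \sum_(y < X) rank N ((WA p).2 y) * N ^ y.

Lemma digits_lt b (f : nat -> nat) K :
  (forall y, f y < b) -> \sum_(y < K) f y * b ^ y < b ^ K.
Proof.
move=> lt; elim: K => [|K IH]; first by rewrite big_ord0.
rewrite big_ord_recr expnS; apply: leq_trans (leq_mul (lt K) (leqnn (b ^ K))).
by rewrite mulSn -addSn leq_add2r.
Qed.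

Lemma digits_inj b (f g : nat -> nat) K :
  (forall y, f y < b) -> (forall y, g y < b) ->
  \sum_(y < K) f y * b ^ y = \sum_(y < K) g y * b ^ y ->
  forall y, y < K -> f y = g y.
Proof.
move=> lf lg; elim: K => [//|K IH]; rewrite !big_ord_recr /= addnC [RHS]addnC.
move=> /eqP; rewrite pair_inj ?digits_lt // => /andP[/eqP eK /eqP /IH eq] y.
by rewrite ltnS leq_eqVlt => /orP[/eqP->//|]; apply: eq.
Qed.

Lemma N_gt0 : 0 < N. Proof. by rewrite /N addn2. Qed.

Lemma code_lt p : code p < n * N ^ X.
Proof.
apply: leq_trans (leq_mul (WA_lt p) (leqnn (N ^ X))).
rewrite mulSn addnC -addnS leq_add2l.
apply: (@digits_lt N (fun y => rank N ((WA p).2 y))) => y.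
exact/rank_lt/N_gt0.
Qed.

Lemma code_inj p q : code p = code q ->
  (WA p).1 = (WA q).1 /\ forall y, y < X -> (WA p).2 y = (WA q).2 y.
Proof.
have lt r y : rank N ((WA r).2 y) < N by apply/rank_lt/N_gt0.
move=> /eqP; rewrite pair_inj ?(digits_lt _ (lt _)) // => /andP[/eqP e1 /eqP e2].
split=> // y ly; rewrite -[LHS]T_rank ?WA_in // -[RHS]T_rank ?WA_in //.
by congr T; apply: (digits_inj (lt p) (lt q) e2).
Qed.

(** Entry [y] of [next] reads only entries up to [y], so the [X] digits determine all extensions.
    This is why one route per code is enough. *)
Lemma code_rcons p q w : code p = code q -> code (rcons p w) = code (rcons q w).
Proof.
move=> /code_inj[e1 e2]; rewrite /code !worst_arrive_rcons /= e1.
congr (_ + _); apply: eq_bigr => y _; congr (rank _ _ * _).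
by apply: eq_bigr => k _; rewrite e2 //; have := ltn_ord y; lia.
Qed.

Definition good p : bool := ((WA p).1 == z) && ((WA p).2 x < H).

Lemma good_code p q : code p = code q -> good p = good q.
Proof. by move=> /code_inj[e1 e2]; rewrite /good e1 e2. Qed.

(** The routes [ps] exist in the proof only; the machine stores the last vertex and the vector of
    each. *)
Record queue (ps : seq (seq 'I_n)) (h : hstate) : Prop := Queue {
  queue_tail : var h rtail = size ps;
  queue_toff : var h rtoff = size ps * X;
  queue_V : forall q, q < size ps -> arr h aQV q = (WA (nth [::] ps q)).1;
  queue_A : forall q y, q < size ps -> y < X ->
    arr h aQA (q * X + y) = (WA (nth [::] ps q)).2 y;
  queue_vis : forall c, (0 < arr h aVis c) = (c \in map code ps);
  queue_uniq : uniq (map code ps) }.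

(** Agreement of [aQA] is required below the tail only, because [extend] writes its candidate just
    beyond. *)
Lemma queue_eq ps h h' : var h' rtail = var h rtail ->
  var h' rtoff = var h rtoff -> arr h' aQV = arr h aQV ->
  (forall i, i < size ps * X -> arr h' aQA i = arr h aQA i) ->
  arr h' aVis = arr h aVis -> queue ps h -> queue ps h'.
Proof.
move=> et eo eV eA evis [qt qo qV qA qs qu]; split=> //.
- by rewrite et.
- by rewrite eo.
- by rewrite eV.
- move=> q y lq ly; rewrite eA ?qA //.
  have : q.+1 * X <= size ps * X by rewrite leq_mul2r lq orbT.
  by rewrite mulSn; lia.
- by rewrite evis.
Qed.

Definition add_route p ps : seq (seq 'I_n) :=
  if code p \in map code ps then ps else rcons ps p.

Lemma enqueue_spec h ps p : globals h -> queue ps h ->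
  var h rcv = (WA p).1 ->
  (forall y, y < X -> arr h aQA (size ps * X + y) = (WA p).2 y) ->
  wp enqueue h (fun k h' => k <= 3 * X + 8 /\ queue (add_route p ps) h').
Proof.
move=> [hd tm os [cP cC] tb] Q0 hcv hA.
have [_ qo _ _ _ _] := Q0.
apply: wp_sequ; apply: wp_assign; apply: wp_sequ.
apply: (@wp_for _ (fun y h' => var h' rcode = (WA p).1 * N ^ X +
  \sum_(i < y) rank N ((WA p).2 i) * N ^ i) X 1) => //=.
- exact: header_X hd.
- by rewrite hcv cC ?WA_lt // big_ord0 addn0.
- move=> y h1 ly F1 vy vc; apply: wp_assign; split=> //=.
  rewrite vc vy big_ord_recr /= addnA; congr (_ + _).
  use_frame F1; rewrite /= qo hA // (offset_Y os) // cP //.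
  exact/times_lt/WA_in.
move=> k1 h1 lk1 F1 _ vc; rewrite -/(code p) in vc.
have Q1 : queue ps h1.
  by apply: queue_eq Q0; try move=> i _; use_frame F1.
have X1 : var h1 rX = X by use_frame F1; rewrite /= (header_X hd).
have cv1 : var h1 rcv = (WA p).1 by use_frame F1.
have A1 y : y < X -> arr h1 aQA (size ps * X + y) = (WA p).2 y.
  by move=> ly; use_frame F1; apply: hA.
have [qt {}qo qV qA qs qu] := Q1.
apply: wp_cond => /= [|/eqP]; rewrite vc ?eqn0Ngt qs => pin.
  by apply: wp_assign; split; [lia | rewrite /add_route pin].
apply: wp_sequ; apply: wp_put; apply: wp_sequ; apply: wp_put.
apply: wp_sequ; apply: wp_assign; apply: wp_assign; split; first by lia.
rewrite /add_route (negbTE pin); split=> /=; rewrite ?size_rcons ?map_rcons.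
- by rewrite qt addn1.
- by rewrite qo X1 mulSn addnC.
- move=> q; rewrite ltnS nth_rcons qt cv1 => lq.
  by case: (ltngtP q (size ps)) lq => // lq _; apply: qV.
- move=> q y; rewrite ltnS nth_rcons => lq ly.
  by case: (ltngtP q (size ps)) lq => [lq|//|->] _; [apply: qA|apply: A1].
- move=> c; rewrite mem_rcons inE vc; case: eqP => // _; exact: qs.
- by rewrite rcons_uniq pin.
Qed.

Lemma extend_spec h ps q (w : 'I_n) : globals h -> queue ps h -> q < size ps ->
  var h rhoff = q * X -> var h rv = (WA (nth [::] ps q)).1 -> var h rw = w ->
  wp extend h (fun k h' => [/\ k <= X * (3 * X + 6) + 2, queue ps h'
    & forall y, y < X ->
        arr h' aQA (size ps * X + y) = (WA (rcons (nth [::] ps q) w)).2 y]).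
Proof.
move=> [hd tm os cd tb] Q0 lq hoff hv hw.
have [qt qo _ qA _ _] := Q0.
set p := nth [::] ps q in hv *.
apply: (@wp_for _ (fun y h' =>
  (forall i, i < size ps * X -> arr h' aQA i = arr h aQA i) /\
  forall y', y' < y ->
    arr h' aQA (size ps * X + y') = (WA (rcons p w)).2 y') X (3 * X + 4)) => //=.
- exact: header_X hd.
- move=> y h1 ly F1 vy [old new]; apply: wp_sequ; apply: wp_assign.
  apply: wp_sequ.
  apply: (@wp_for _ (fun k h' => var h' rval =
    \max_(i < k) worstd es ((WA p).2 (y - i)) (WA p).1 w i) y.+1 1) => //=.
  + by rewrite vy addn1.
  + by rewrite big_ord0.
  + move=> k h2 lk F2 vk vmax; apply: wp_assign; split=> //=.
    rewrite vmax vk -maxnE big_ord_recr /=; congr maxn.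
    have -> : var h2 ry = y by use_frame F2.
    have -> : arr h2 aQA (var h2 rhoff + (y - k)) = (WA p).2 (y - k).
      use_frame F2; rewrite /=; use_frame F1; rewrite hoff old ?qA //.
        by lia.
      have : q.+1 * X <= size ps * X by rewrite leq_mul2r lq orbT.
      by rewrite mulSn; lia.
    use_frame F2; rewrite /=; use_frame F1; rewrite hv hw.
    rewrite (offset_K os) ?(offset_V os) ?(offset_W os) ?WA_lt //; last by lia.
    apply: tb; rewrite ?WA_lt ?WA_in //; lia.
  + move=> k h2 lk F2 _ vmax; apply: wp_put; split; first by lia.
    have -> : eval input h2 (Var rtoff +~ Var ry) = size ps * X + y.
      by rewrite /=; use_frame F2; rewrite /=; use_frame F1; rewrite qo vy.
    split=> [i li|y' ly'] /=.
      rewrite ifF; last by lia.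
      by use_frame F2; apply: old.
    rewrite eqn_add2l worst_arrive_rcons /=; case: eqP => [->|ny].
      by rewrite vmax.
    use_frame F2; rewrite /= new; last by lia.
    by rewrite worst_arrive_rcons.
- move=> k h1 lk F1 _ [old new]; split=> //; first by lia.
  by apply: queue_eq Q0 => //; use_frame F1.
Qed.

Lemma add_route_cat p ps : exists t, add_route p ps = ps ++ t.
Proof.
rewrite /add_route; case: ifP => _; first by exists [::]; rewrite cats0.
by exists [:: p]; rewrite cats1.
Qed.

Lemma code_add_route p ps : code p \in map code (add_route p ps).
Proof.
rewrite /add_route; case: ifP => // _.
by rewrite map_rcons mem_rcons inE eqxx.
Qed.

Lemma size_queue ps h : queue ps h -> size ps <= n * N ^ X.
Proof.
case=> _ _ _ _ _ qu; rewrite -(size_map code) -[leqRHS](size_iota 0).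
apply: uniq_leq_size qu _ => _ /mapP[p _ ->].
by rewrite mem_iota code_lt.
Qed.

(* The first q routes of the queue have been extended in all ways. *)
Record explored (q : nat) (h : hstate) (ps : seq (seq 'I_n)) : Prop := Explored {
  explored_globals : globals h;
  explored_queue : queue ps h;
  explored_head : var h rhead = q;
  explored_hoff : var h rhoff = q * X;
  explored_leq : q <= size ps;
  explored_nil : code [::] \in map code ps;
  explored_rcons : forall i (w : 'I_n), i < q ->
    code (rcons (nth [::] ps i) w) \in map code ps;
  explored_acc : (0 < var h racc) = has good (take q ps) }.

Definition round_time := n * (X * (3 * X + 9) + 13) + 8.
Definition search_time := n * N ^ X * round_time.+1 + 3 * X + 14.

Lemma search_spec h : globals h -> var h racc = 0 ->
  (forall i, arr h aQA i = 0) -> (forall i, arr h aVis i = 0) ->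
  wp search h (fun k h' => k <= search_time /\
    (0 < var h' racc <-> exists p, last s p = z /\ (WA p).2 x < H)).
Proof.
move=> gl acc0 QA0 Vis0.
do 5 (apply: wp_sequ; apply: wp_assign).
set h0 := set_var _ _ _.
have gl0 : globals h0 by do 5 apply: globals_set => //.
have Q0 : queue [::] h0 by split=> // c; rewrite /= Vis0.
apply: wp_sequ; apply: wp_use.
  apply: (@enqueue_spec h0 [::] [::]) => //=.
  by case: gl => hd *; apply: header_s hd.
move=> k1 h1 F1 [lk1 Q1].
have gl1 : globals h1 by apply: globals_agree gl0; apply: frame_agree F1.
apply: (@wp_loop _ (fun q h' => exists ps, explored q h' ps)
  (n * N ^ X) round_time).
- exists (add_route [::] [::]); split=> //; rewrite ?code_add_route ?take0 //;
    by use_frame F1; rewrite /= ?acc0.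
- move=> q h2 [ps [gl2 Q2 hh ho lq cn cr ca]] /=.
  rewrite (queue_tail Q2) hh subn_gt0 => ltq.
  split; first exact: leq_trans ltq (size_queue Q2).
  set p := nth [::] ps q.
  apply: wp_sequ; apply: wp_assign; apply: wp_sequ.
  set h3 := set_var _ _ _.
  have vv : var h3 rv = (WA p).1 by rewrite /= hh (queue_V Q2).
  have gl3 : globals h3 by apply: globals_set.
  have hd3 : header h3 by case: gl3.
  (* Routes are only appended, so facts about the earlier entries of the queue persist. *)
  apply: (@wp_for _ (fun w h' => exists t, queue (ps ++ t) h' /\
    forall w' : 'I_n, w' < w -> code (rcons p w') \in map code (ps ++ t)) n
    (X * (3 * X + 9) + 11)) => //.
  + exact: header_n hd3.
  + exists [::]; split=> //; rewrite cats0; exact: queue_eq Q2.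
  + move=> w h4 lw F4 vw [t [Q4 cw]].
    have gl4 : globals h4 by apply: globals_agree gl3; apply: frame_agree F4.
    have lq4 : q < size (ps ++ t) by rewrite size_cat ltn_addr.
    have pE : nth [::] (ps ++ t) q = p by rewrite nth_cat ltq.
    apply: wp_sequ; apply: wp_use.
      apply: (@extend_spec h4 (ps ++ t) q (Ordinal lw)) => //.
      * by use_frame F4.
      * by rewrite pE -vv; use_frame F4.
    move=> k5 h5 F5 [lk5 Q5 A5]; rewrite pE in A5.
    apply: wp_sequ; apply: wp_assign; apply: wp_use.
      apply: (@enqueue_spec _ (ps ++ t) (rcons p (Ordinal lw))).
      * apply: globals_set => //.
        by apply: globals_agree gl4; apply: frame_agree F5.
      * exact: queue_eq Q5.
      * by rewrite worst_arrive_rcons /= -vw; use_frame F5.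
      * exact: A5.
    move=> k6 h6 F6 [lk6 Q6]; split; first by lia.
    have [t' tE] := add_route_cat (rcons p (Ordinal lw)) (ps ++ t).
    exists (t ++ t'); rewrite catA -tE; split; first exact: queue_eq Q6.
    move=> w'; rewrite ltnS leq_eqVlt => /orP[/eqP ew|lw'].
      have -> : w' = Ordinal lw by apply: val_inj.
      exact: code_add_route.
    by rewrite tE map_cat mem_cat cw.
  + move=> k4 h4 lk4 F4 _ [t [Q4 cw]].
    have gl4 : globals h4 by apply: globals_agree gl3; apply: frame_agree F4.
    have lq4 : q < size (ps ++ t) by rewrite size_cat ltn_addr.
    have pE : nth [::] (ps ++ t) q = p by rewrite nth_cat ltq.
    have hh4 : var h4 rhead = q by use_frame F4.
    have ho4 : var h4 rhoff = q * X by use_frame F4.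
    have [hd4 tm4 _ _ _] := gl4.
    have condE : (eval input h4 (distance (Var rv) (Var rz) +~
        (Get aQA (Var rhoff +~ Var rx) +~ Cst 1 -~ Var rH)) == 0) = good p.
      have vv4 : var h4 rv = (WA p).1 by rewrite -vv; use_frame F4.
      rewrite /= vv4 (header_z hd4) (header_x hd4) (timed_H tm4) ho4.
      rewrite (queue_A Q4) // pE /good !addn_eq0 !subn_eq0 -eqn_leq addn1.
      by rewrite -[_ < H]/(_ <= _).
    have fin acc h5 : agree 10 8 h4 h5 ->
        (forall i, 22 <= i <= 25 -> var h5 i = var h4 i) ->
        (forall a, 8 < a -> arr h5 a = arr h4 a) ->
        var h5 racc = acc ->
        (0 < acc) = has good (take q ps) || good p ->
        exists ps', explored q.+1 (set_var (set_var h5 rhead (q + 1))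
          rhoff (q * X + X)) ps'.
      move=> ag vs as_ vacc accE; exists (ps ++ t); split=> //.
      * do 2 apply: globals_set => //.
        exact: globals_agree gl4.
      * by apply: queue_eq Q4; rewrite /= ?vs ?as_ // => i _; rewrite as_.
      * by rewrite /= addn1.
      * by rewrite /= mulSn addnC.
      * by rewrite map_cat mem_cat cn.
      * move=> i w; rewrite ltnS leq_eqVlt => /orP[/eqP->|li].
          by rewrite pE cw.
        by rewrite nth_cat (ltn_trans li ltq) map_cat mem_cat cr.
      * rewrite /= vacc accE (take_nth [::]) // pE has_rcons orbC.
        by rewrite takel_cat // ltnW.
    have acc4 : var h4 racc = var h2 racc by use_frame F4.
    apply: wp_sequ; apply: wp_cond => [|/eqP]; rewrite ?lt0n condE => gp.
      apply: wp_assign; apply: wp_sequ; apply: wp_assign; apply: wp_assign.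
      split; first by rewrite /round_time; lia.
      rewrite /= hh4 ho4 -[var h4 7]/(var h4 rX) (header_X hd4).
      apply: (fin (var h2 racc)) => //; first exact: agree_set_var.
        by move=> i hi /=; rewrite ifF //; lia.
      by rewrite (negbTE gp) orbF.
    apply: wp_assign; apply: wp_sequ; apply: wp_assign; apply: wp_assign.
    split; first by rewrite /round_time; lia.
    rewrite /= hh4 ho4 -[var h4 7]/(var h4 rX) (header_X hd4).
    apply: (fin 1) => //; first exact: agree_set_var.
      by move=> i hi /=; rewrite ifF //; lia.
    by rewrite gp orbT.
- move=> q k h2 lk + [ps [gl2 Q2 hh ho lq cn cr ca]].
  rewrite /= (queue_tail Q2) hh => /eqP; rewrite subn_eq0 => lq'.
  have {lq lq'} qE : q = size ps by apply/eqP; rewrite eqn_leq lq.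
  split; first by rewrite /search_time; lia.
  (* By induction the code of [p] belongs to some queued route; every extension of that route was
     enqueued, and it has the same code as the corresponding extension of [p]. *)
  have all_codes p : code p \in map code ps.
    elim/last_ind: p => // p w /(nthP 0)[i]; rewrite size_map => li.
    rewrite (nth_map [::]) // => /(@code_rcons _ _ w) <-.
    by apply: cr; rewrite qE.
  rewrite ca qE take_size; split.
    case/hasP => p _ /andP[/eqP lz lt]; exists p; split=> //.
    by apply: val_inj; rewrite /= -lz worst_arrive1.
  case=> p [lz lt]; have /mapP[p' p'ps cp] := all_codes p.
  apply/hasP; exists p' => //; rewrite -(good_code cp) /good lt.
  by rewrite worst_arrive1 lz eqxx.
Qed.

(** * Running time and transfer to the machine *)

Definition run_time :=
  7 * m + 16 * X + 12 * n + X * (4 * N + 7) + fill_time + search_time + 60.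

Lemma program_spec : wp program (HState (fun=> 0) (fun _ _ => 0)) (fun k h' =>
  k <= run_time /\
  (0 < var h' racc <-> exists p, last s p = z /\ (WA p).2 x < H)).
Proof.
apply: wp_sequ; apply: wp_use; first exact: load_header_spec.
move=> k1 h1 F1 [lk1 hd1 _ _].
apply: wp_sequ; apply: wp_use; first exact: list_times_spec.
move=> k2 h2 F2 [lk2 tm2].
have hd2 : header h2.
  by apply: (@header_agree 8 0 h1) => //; apply: frame_agree F2.
apply: wp_sequ; apply: wp_use; first exact: tabulate_offsets_spec.
move=> k3 h3 F3 [lk3 os3].
have ag3 : agree 10 1 h2 h3 by apply: frame_agree F3.
have hd3 := header_agree (isT : 8 <= 10) ag3 hd2.
have tm3 := timed_agree (isT : 10 <= 10) (isT : 1 <= 1) ag3 tm2.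
apply: wp_sequ; apply: wp_use.
  apply: tabulate_codes_spec => //.
  by use_frame F3; use_frame F2; use_frame F1.
move=> k4 h4 F4 [lk4 cd4].
have ag4 : agree 10 5 h3 h4 by apply: frame_agree F4.
have hd4 := header_agree (isT : 8 <= 10) ag4 hd3.
have tm4 := timed_agree (isT : 10 <= 10) (isT : 1 <= 5) ag4 tm3.
have os4 := offsets_agree (isT : 5 <= 5) ag4 os3.
apply: wp_sequ; apply: wp_use; first exact: fill_worst_spec.
move=> k5 h5 F5 [lk5 tb5].
have ag5 : agree 10 7 h4 h5 by apply: frame_agree F5.
have hd5 := header_agree (isT : 8 <= 10) ag5 hd4.
have tm5 := timed_agree (isT : 10 <= 10) (isT : 1 <= 7) ag5 tm4.
have os5 := offsets_agree (isT : 5 <= 7) ag5 os4.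
have cd5 := coded_agree (isT : 7 <= 7) ag5 cd4.
apply: wp_use.
  apply: search_spec => // [|i|i];
    by use_frame F5; use_frame F4; use_frame F3; use_frame F2; use_frame F1.
move=> k6 h6 F6 [lk6 acc6]; split=> //.
by rewrite /run_time; lia.
Qed.

Lemma code_bound : 0 < m -> 0 < x0 -> N ^ X <= 8 ^ 4 * m ^ (2 * x0).
Proof.
move=> m0 x00; have P0 : 0 < m ^ (2 * x0) by rewrite expn_gt0 m0.
have [lm|lm] := ltnP m 4.
  (* For at most three arcs, [N <= 8] and [X <= m + 1 <= 4]. *)
  rewrite -[leqLHS]muln1; apply: leq_mul => //.
  apply: (@leq_trans (8 ^ X)); first by rewrite leq_exp2r // /N; lia.
  by rewrite leq_pexp2l // /X ltnS (leq_trans (geq_minr _ _)) // -ltnS.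
have : 0 < x by rewrite leq_min x00.
have : x <= x0 by apply: geq_minl.
rewrite /X; case: x => // y ly _.
apply: (@leq_trans ((4 * m) ^ y.+2)); first by rewrite leq_exp2r // /N; lia.
have -> : (4 * m) ^ y.+2 = 4 ^ y * 4 ^ 2 * (m ^ y * m ^ 2).
  by rewrite expnMn -[y.+2]addn2 !expnD.
(* Here [y] is the cut budget minus one, and [4 <= m] absorbs [4 ^ y] into [m ^ y]; only two factors
   4 remain. *)
apply: (@leq_trans (m ^ y * 4 ^ 2 * (m ^ y * m ^ 2))).
  apply/leq_mul/leqnn/leq_mul/leqnn; case: y {ly} => // y.
  by rewrite leq_exp2r.
have -> : m ^ y * 4 ^ 2 * (m ^ y * m ^ 2) = 4 ^ 2 * m ^ (2 * y.+1).
  by rewrite [m ^ y * 4 ^ 2]mulnC -mulnA -!expnD; congr (_ * m ^ _); lia.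
apply: leq_mul; first by [].
by rewrite leq_pexp2l // leq_mul2l.
Qed.

Lemma run_time_bound c : 0 < n -> 0 < m -> 0 < x0 ->
  N ^ X <= c * m ^ (2 * x0) ->
  run_time <= (800 + 120 * c) * (n ^ 3 * m ^ (2 * x0) * x0 ^ 2).
Proof.
move=> n0 m0 x00 codes.
apply: polynomial_bound codes => //; last by rewrite /N; lia.
  by rewrite -[m * m]/(m ^ 2) leq_pexp2l // leq_pmulr.
by rewrite /X; have := geq_minl x0 m; rewrite -/x; lia.
Qed.

Lemma size_input : size input = 6 + 4 * m.
Proof.
rewrite /input /encode size_cat size_flatten /shape -map_comp.
rewrite (eq_map (g := fun=> 4)) // sumnE big_map big_const_seq count_predT.
by rewrite iter_addn addn0.
Qed.

(** The input length [6 + 4 * m] is computed from the arc count in cell 1. Only odd registers are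
    touched, so all variables still read 0. *)
Definition measure_input : cmd :=
  Seq (Const 3 1) (Seq (Read 1 3) (Seq (Add 1 1 1) (Seq (Add 1 1 1)
  (Seq (Const 3 6) (Add 1 1 3))))).

Lemma measure_input_spec : exists st,
  exec measure_input (init input) 6 st /\
  represents input (HState (fun=> 0) (fun _ _ => 0)) st.
Proof.
eexists; split.
  rewrite -[6]/(1 + (1 + (1 + (1 + (1 + 1))))).
  by do 5 (apply: exec_seq; first by constructor); constructor.
split=> [|i|i|a i _] //.
- by rewrite size_input /= /upd /= -/m; lia.
- rewrite /= /upd /=; have -> : (2 * i == 1) = false by lia.
  by have -> : (2 * i == 3) = false by lia.
- by rewrite /= nth_default // -addnA leq_addr.
Qed.

Lemma decide_spec K : com_cost program <= K -> exists k st,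
  [/\ exec (Seq measure_input (compile program)) (init input) k st,
      k <= 6 + K * run_time
    & accepts st <-> exists p, last s p = z /\ (WA p).2 x < H].
Proof.
move=> leK; have [st0 [x0' rep0]] := measure_input_spec.
have [k [h [xh [lk acc]]]] := program_spec.
have [k' [st [xst lk' [_ rv _ _]]]] :=
  compile_correct xh program_ok leK rep0.
exists (6 + k'), st; split; first exact: exec_seq x0' xst.
  by rewrite leq_add2l (leq_trans lk') // leq_mul2l lk orbT.
(* Register 0 houses variable 0, the flag raised by the search. *)
by rewrite /accepts -[0]/(2 * 0) rv.
Qed.

End Correctness.

(* One program decides every instance, whatever the order es in which the arcs
   are listed in the input.  The product in the bound vanishes when x = 0 or
   |E| = 0, so the O-bound is read over |E| >= 1 and x >= 1 (|V| >= 1 as s is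
   a vertex); correctness and termination are asserted for all instances. *)
Theorem theorem18 :
  exists (p : cmd) (C : nat),
  forall (n : nat) (E : tgraph 'I_n) (s z : 'I_n) (x delta : nat)
         (es : seq (time_arc 'I_n)),
    perm_eq es (enum_fset E) ->
    exists (k : nat) (st : state),
      [/\ exec p (init (encode es s z x delta)) k st,
          accepts st <-> delay_robust_path E s z x delta
        & 0 < #|` E| -> 0 < x ->
          k <= C * (#|'I_n| ^ 3 * #|` E| ^ (2 * x) * x ^ 2)].
Proof.
have [K leK] : exists K, com_cost program <= K by exists (com_cost program).
have [c cE] : exists c, c = 8 ^ 4 by exists (8 ^ 4).
exists (Seq measure_input (compile program)), (6 + K * (800 + 120 * c)).
move=> n E s z x delta es eE.
have [k [st [xst lk acc]]] := decide_spec es s z x delta leK.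
have es_uniq : uniq es by rewrite (perm_uniq eE) fset_uniq.
have esE : es =i E by move=> e; rewrite (perm_mem eE).
exists k, st; split=> //.
  rewrite acc; symmetry.
  by apply: delay_robust_path_worst_arrive => // e; apply: horizon_gt.
rewrite -[#|` E|]/(size (enum_fset E)) -(perm_size eE) card_ord => m0 x0.
have n0 : 0 < n by apply: leq_ltn_trans (ltn_ord s).
set W := n ^ 3 * _ * _.
have W0 : 0 < W by rewrite !muln_gt0 !expn_gt0 n0 m0 x0.
apply: leq_trans lk _; rewrite mulnDl leq_add //; first by rewrite leq_pmulr.
rewrite -mulnA leq_mul2l run_time_bound ?orbT // cE.
exact: code_bound.
Qed.
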